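(* Let $\operatorname{char}K\neq2$. The Poisson superalgebra $\mathbf P=\mathrm{Poisson}(V_0,V_1,V_2)$ admits an algebraic quantization: there is an associative product $*$ on $\mathbf P[t]=\mathbf P\otimes_K K[t]$, compatible with the $\mathbb Z_2$-grading $\mathbf P[t]=\mathbf P_{\bar0}[t]\oplus\mathbf P_{\bar1}[t]$, such that $a*b\equiv a\cdot b \pmod t$ and $a*b-(-1)^{|a||b|}b*a\equiv t\{a,b\}\pmod{t^2}$ for all $a,b\in\mathbf P$, and $f*t=t*f=ft$ for all $f\in\mathbf P[t]$.
   Context: Let $H_\infty=\Lambda(x_i,y_i\mid i\ge0)$ be the Grassmann algebra over $K$ on odd generators $x_i,y_i$, a Poisson superalgebra with bracket determined by $\{y_i,x_j\}=\delta_{ij}$, $\{x_i,x_j\}=\{y_i,y_j\}=0$ and the super Leibniz rule. For a $0/1$ tuple $\alpha$ with finite support write $x^\alpha=\prod x_i^{\alpha_i}$ (increasing order), similarly $y^\beta$, and $\bar\alpha=\max\{i:\alpha_i\ne0\}$. Let $\widetilde H$ be the space of formal sums $c\cdot1+\sum\lambda_{\alpha,\beta}x^\alpha y^\beta$ over monomials with $\beta\ne0$ and $\bar\alpha<\bar\beta$; the product and bracket of $H_\infty$ extend to $\widetilde H$ (each coefficient of a product or bracket is a finite sum), making it a Poisson superalgebra. Put $V_i=\sum_{k\ge0}\big(\prod_{n=0}^{k-1}x_{i+3n}x_{i+3n+1}\big)y_{i+3k}\in\widetilde H$, and let $\mathbf P$ be the smallest unital subalgebra of $\widetilde H$ containing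 $V_0,V_1,V_2$ and closed under the associative product and the Poisson bracket. *)

(* Defs.v *)
From HB Require Import structures.
From mathcomp Require Import all_boot all_order all_algebra.
From mathcomp Require Import finmap.
From mathcomp Require Import boolp classical_sets fsbigop.
Set Implicit Arguments. Unset Strict Implicit. Unset Printing Implicit Defensive.
Import Order.TTheory GRing.Theory Num.Theory.
Local Open Scope ring_scope.

(* A monomial x^alpha y^beta (alpha, beta 0/1 tuples of finite support) is
   represented by the pair (A, B) of the finite supports: A = {i | alpha_i = 1}
   (indices of the x's), B = {i | beta_i = 1} (indices of the y's).
   x^A y^B is the ordered product (prod_{i in A, increasing} x_i)
   (prod_{j in B, increasing} y_j). *)
Definition mon := ({fset nat} * {fset nat})%type.

Section Grassmann.
Variable K : fieldType.

Definition ser := mon -> K.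

Definition zeroS : ser := fun _ => 0.
Definition oneS : ser := fun m => if m == (fset0, fset0) then 1 else 0.
Definition addS (f g : ser) : ser := fun m => f m + g m.
Definition scaleS (c : K) (f : ser) : ser := fun m => c * f m.

Definition ninv (S T : {fset nat}) : nat :=
  (\sum_(a <- S) \sum_(b <- T) (b < a))%N.

(* sign such that (x^A1 y^B1)(x^A2 y^B2) = sgnM * x^(A1 u A2) y^(B1 u B2)
   when A1, A2 and B1, B2 are disjoint *)
Definition sgnM (m1 m2 : mon) : K :=
  (-1) ^+ (#|` m1.2| * #|` m2.1| + ninv m1.1 m2.1 + ninv m1.2 m2.2)%N.

(* Product of the (completed) Grassmann algebra: every coefficient is a
   finite sum over the splittings of the monomial. *)
Definition mulS (f g : ser) : ser := fun m =>
  \sum_(A1 <- fpowerset m.1) \sum_(B1 <- fpowerset m.2)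
     sgnM (A1, B1) (m.1 `\` A1, m.2 `\` B1)%fset
       * f (A1, B1) * g (m.1 `\` A1, m.2 `\` B1)%fset.

Definition ldx (i : nat) (f : ser) : ser := fun m =>
  if i \in m.1 then 0
  else (-1) ^+ (count (fun a : nat => (a < i)%N) m.1) * f (i |` m.1, m.2)%fset.
Definition ldy (i : nat) (f : ser) : ser := fun m =>
  if i \in m.2 then 0
  else (-1) ^+ (#|` m.1| + count (fun b : nat => (b < i)%N) m.2)%N * f (m.1, i |` m.2)%fset.
Definition rdx (i : nat) (f : ser) : ser := fun m =>
  if i \in m.1 then 0
  else (-1) ^+ (#|` m.2| + count (fun a : nat => (i < a)%N) m.1)%N * f (i |` m.1, m.2)%fset.
Definition rdy (i : nat) (f : ser) : ser := fun m =>
  if i \in m.2 then 0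
  else (-1) ^+ (count (fun b : nat => (i < b)%N) m.2) * f (m.1, i |` m.2)%fset.

(* Poisson bracket with {y_i, x_j} = delta_ij, {x_i,x_j} = {y_i,y_j} = 0,
   extended by the super Leibniz rule:
     {f, g} = sum_i (f <-d/dy_i)(d/dx_i-> g) + (f <-d/dx_i)(d/dy_i-> g).
   Each coefficient is the sum over i of a family with finite support when
   f, g lie in H~ (the sum \sum_(i \in setT) is the finitely supported sum of
   mathcomp-classical). *)
Definition brS (f g : ser) : ser := fun m =>
  \sum_(i \in [set: nat]) (mulS (rdy i f) (ldx i g) m + mulS (rdx i f) (ldy i g) m).

(* bar alpha + 1, with 0 for the empty set *)
Definition barS (S : {fset nat}) : nat := (\max_(i <- S) i.+1)%N.

(* The space H~ (for documentation: P below lies inside it). *)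
Definition inHt (f : ser) : Prop :=
  forall m, f m != 0 -> m = (fset0, fset0) \/ (barS m.1 < barS m.2)%N.

Definition Vmon (i k : nat) : mon :=
  (seq_fset tt ([seq (i + 3 * n)%N | n <- iota 0 k] ++ [seq (i + 3 * n + 1)%N | n <- iota 0 k]),
   seq_fset tt [:: (i + 3 * k)%N]).

Definition V (i : nat) : ser := fun m => if `[< exists k, m = Vmon i k >] then 1 else 0.

Inductive inP : ser -> Prop :=
| inP_V (j : nat) : (j < 3)%N -> inP (V j)
| inP_one : inP oneS
| inP_add f g : inP f -> inP g -> inP (addS f g)
| inP_scale c f : inP f -> inP (scaleS c f)
| inP_mul f g : inP f -> inP g -> inP (mulS f g)
| inP_br f g : inP f -> inP g -> inP (brS f g).

Definition parity (m : mon) : bool := odd (#|` m.1| + #|` m.2|).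
Definition homog (p : bool) (f : ser) : Prop := forall m, f m != 0 -> parity m = p.

(* P[t] = P (x)_K K[t]: polynomials in t, i.e. coefficient sequences
   c : nat -> ser (c n = coefficient of t^n) with coefficients in P and finite
   support. *)
Definition tser := nat -> ser.
Definition inPt (c : tser) : Prop :=
  (forall n, inP (c n)) /\ exists N, forall n, (N <= n)%N -> c n = zeroS.
Definition addT (c d : tser) : tser := fun n => addS (c n) (d n).
Definition scaleT (k : K) (c : tser) : tser := fun n => scaleS k (c n).
Definition homogT (p : bool) (c : tser) : Prop := forall n, homog p (c n).
Definition constT (a : ser) : tser := fun n => if n == 0%N then a else zeroS.
Definition tT : tser := fun n => if n == 1%N then oneS else zeroS.
Definition shiftT (c : tser) : tser := fun n => if n is n'.+1 then c n' else zeroS.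

End Grassmann.

(* Main.v *)
(** The quantization is the normal ordered Clifford product: y_i * x_i + x_i * y_i = t,
    so f * g = sum_r t^r B_r(f, g), where B_r contracts r letters y of f with the
    corresponding letters x of g.  It is associative because, up to the sign reordering
    x_A y_B into x_0 y_0 x_1 y_1 ..., it is a graded tensor product of rank one Clifford
    algebras, and it converges on H~ because the largest index of a monomial of H~ is
    carried by a y alone.

    The point is that P[t] is closed under *.  P is generated as an associative algebra
    by the Lie superalgebra L of V_0, V_1, V_2, whose elements have degree 1 in y, so that
    a * g = a g + t (a |> g) with a |> g = B_1(a, g) a derivation in g; hence it suffices
    that L is closed under the pre-Lie product |>.  As a |> (b |> g) -+ b |> (a |> g) =
    {a, b} |> g, only V_j |> w for iterated brackets w matters.  Since
    V_i = y_i + x_i x_(i+1) V_(i+3), such w are multiples of monomials x_s V_n, and for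
    those V_j |> w and w |> V_j are multiples of one monomial which never cancel in
    {V_j, w} when 2 is invertible: V_j |> w is a multiple of {V_j, w}. *)

(* The bracket is only the supercommutator of the first-order term |>, and closure under brackets
   does not by itself give closure under |>; here it comes from the two halves of {V_j, w} being
   proportional to one monomial.

   Associativity is checked once, for polynomial structure constants over finitely many indices, and
   then read coefficient by coefficient in t. The order t^1 is a cocycle identity, from which the
   Leibniz rules of d/dx_i and of |> follow by inserting y_i; the order t^2, for elements of degree
   at most 1 in y, is the pre-Lie identity.

   Two kinds of infinity have to be controlled. In the indices, the generators x_i needed in the
   computations lie outside H~, so the support condition carries a parameter c, which is 0 for H~
   and for all of P. In t, a product must stay polynomial: each contraction consumes a y of the left
   factor, and elements of P have bounded degree in y. *)
Require Import Defs.
From HB Require Import structures.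
From mathcomp Require Import all_boot all_order all_algebra.
From mathcomp Require Import finmap.
From mathcomp Require Import boolp classical_sets fsbigop.
From mathcomp Require Import ring zify.
Set Implicit Arguments. Unset Strict Implicit. Unset Printing Implicit Defensive.
Import GRing.Theory.
Local Open Scope ring_scope.

(** * Monomials in finitely many indices *)

Definition below (N : nat) (A : {fset nat}) : bool := all (fun i => (i < N)%N) A.

(** Built by adjoining the top index, so that sums over monomials factor by induction on [N]. *)
Fixpoint subs (N : nat) : seq {fset nat} :=
  if N is n.+1 then subs n ++ [seq (n |` A)%fset | A <- subs n] else [:: fset0].

Lemma belowP N (A : {fset nat}) :
  reflect (forall i, i \in A -> (i < N)%N) (below N A).
Proof. exact: allP. Qed.

Lemma below_le N N' A : (N <= N')%N -> below N A -> below N' A.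
Proof. by move=> le /belowP h; apply/belowP => i /h /leq_trans; apply. Qed.

Lemma mem_subs N A : (A \in subs N) = below N A.
Proof.
elim: N A => [|N IH] A /=.
  rewrite inE; apply/eqP/belowP => [-> i|h]; first by rewrite inE.
  by apply/fsetP => i; rewrite inE; apply/negbTE/negP => /h.
rewrite mem_cat; apply/orP/belowP => [[|/mapP[B]]|h].
- by rewrite IH => /belowP h i /h /ltnW.
- rewrite IH => /belowP h -> i; rewrite !inE => /predU1P[->//|/h /ltnW] //.
have [NA|NA] := boolP (N \in A).
  right; apply/mapP; exists (A `\ N)%fset; last by rewrite fsetD1K.
  rewrite IH; apply/belowP => i; rewrite !inE => /andP[iN /h].
  by rewrite ltnS leq_eqVlt (negbTE iN).
left; rewrite IH; apply/belowP => i iA; have := h i iA.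
rewrite ltnS leq_eqVlt => /predU1P[ii|//]; by rewrite ii (negbTE NA) in iA.
Qed.

Lemma subs_notin N A : A \in subs N -> N \notin A.
Proof. by rewrite mem_subs => /belowP h; apply/negP => /h; rewrite ltnn. Qed.

Lemma uniq_subs N : uniq (subs N).
Proof.
elim: N => //= N IH; rewrite cat_uniq IH /=; apply/andP; split.
  apply/hasPn => A /mapP[B _ ->]; apply/negP => /subs_notin.
  by rewrite !inE eqxx.
rewrite map_inj_in_uniq // => A B /subs_notin NA /subs_notin NB e.
by rewrite -(fsetU1K NA) -(fsetU1K NB) e.
Qed.

Definition mons (N : nat) : seq mon := [seq (A, B) | A <- subs N, B <- subs N].
Definition belowm (N : nat) (m : mon) := below N m.1 && below N m.2.

Lemma mem_mons N m : (m \in mons N) = belowm N m.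
Proof.
apply/allpairsP/andP => [[[A B] /= [hA hB ->]]|[hA hB]].
  by rewrite -!mem_subs.
by exists m; rewrite !mem_subs; case: m hA hB.
Qed.

Lemma uniq_mons N : uniq (mons N).
Proof. by apply: allpairs_uniq (uniq_subs N) (uniq_subs N) _ => -[? ?] [? ?] _ _ [-> ->]. Qed.

Lemma belowm_le N N' m : (N <= N')%N -> belowm N m -> belowm N' m.
Proof. by move=> le /andP[a b]; rewrite /belowm !(below_le le). Qed.

Notation bits := (bool * bool)%type.
Definition bit (m : mon) (i : nat) : bits := (i \in m.1, i \in m.2).
Definition pb (b : bits) : bool := b.1 (+) b.2.

Lemma bit_ge N m i : belowm N m -> (N <= i)%N -> bit m i = (false, false).
Proof.
move=> /andP[/belowP h1 /belowP h2] le; rewrite /bit; congr (_, _).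
  by apply/negbTE/negP => /h1; rewrite ltnNge le.
by apply/negbTE/negP => /h2; rewrite ltnNge le.
Qed.

Lemma sum_bits (R : nmodType) (f : bits -> R) :
  \sum_(b : bits) f b = f (false, false) + f (false, true) + f (true, false) + f (true, true).
Proof.
transitivity (\sum_(a : bool) \sum_(b : bool) f (a, b)).
  by rewrite pair_bigA /=; apply: eq_bigr => -[].
by rewrite !big_bool /= addrC [f (true, true) + _]addrC [f (false, true) + _]addrC !addrA.
Qed.

(** Distributivity: a monomial below [N] is a free choice of two bits at every index. This reduces
    the associativity of the Clifford product to rank one. *)
Lemma sum_mons_prod (R : comPzRingType) N (phi : nat -> bits -> R) :
  \sum_(m <- mons N) \prod_(0 <= i < N) phi i (bit m i)
  = \prod_(0 <= i < N) \sum_(b : bits) phi i b.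
Proof.
rewrite big_allpairs.
elim: N => [|N IH]; first by rewrite /= !big_seq1 !big_geq.
rewrite big_nat_recr //= -IH sum_bits big_cat /= big_map -big_split /= mulr_suml.
apply: eq_big_seq => A hA; rewrite !big_cat /= !big_map -!big_split /= mulr_suml.
apply: eq_big_seq => B hB.
have nA := subs_notin hA; have nB := subs_notin hB.
have E (a b : {fset nat}) : (forall i, (i < N)%N -> bit (a, b) i = bit (A, B) i) ->
    \prod_(0 <= i < N.+1) phi i (bit (a, b) i)
    = \prod_(0 <= i < N) phi i (bit (A, B) i) * phi N (bit (a, b) N).
  move=> e; rewrite big_nat_recr //=; congr (_ * _).
  by apply: eq_big_nat => i /andP[_ /e ->].
have F (C : {fset nat}) i : (i < N)%N -> (i \in (N |` C)%fset) = (i \in C).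
  by move=> lt; rewrite !inE ltn_eqF.
rewrite !E; try by move=> i lt; rewrite /bit /= ?F.
rewrite /bit /= !inE !eqxx (negbTE nA) (negbTE nB) /= -!mulrDr !addrA; congr (_ * _).
Qed.

(** * The Clifford product *)

(* The exponent mod 2 of the Koszul sign. *)
Definition koszul (N : nat) (P Q : nat -> bool) : bool :=
  \big[addb/false]_(0 <= i < N) \big[addb/false]_(0 <= j < N) [&& (j < i)%N, P i & Q j].
Definition xorsum (N : nat) (P : nat -> bool) : bool := \big[addb/false]_(0 <= i < N) P i.

Lemma eq_koszul N P P' Q Q' : {in gtn N, P =1 P'} -> {in gtn N, Q =1 Q'} ->
  koszul N P Q = koszul N P' Q'.
Proof.
move=> eP eQ; apply: eq_big_nat => i /andP[_ iN]; apply: eq_big_nat => j /andP[_ jN].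
by rewrite eP // eQ.
Qed.

Lemma eq_xorsum N P P' : {in gtn N, P =1 P'} -> xorsum N P = xorsum N P'.
Proof. by move=> e; apply: eq_big_nat => i /andP[_ /e]. Qed.

Lemma koszulDl N P P' Q : koszul N (fun i => P i (+) P' i) Q = koszul N P Q (+) koszul N P' Q.
Proof.
rewrite /koszul -big_split; apply: eq_bigr => i _; rewrite -big_split; apply: eq_bigr => j _.
by case: (j < i)%N (P i) (P' i) (Q j) => [] [] [] [].
Qed.

Lemma koszulDr N P Q Q' : koszul N P (fun i => Q i (+) Q' i) = koszul N P Q (+) koszul N P Q'.
Proof.
rewrite /koszul -big_split; apply: eq_bigr => i _; rewrite -big_split; apply: eq_bigr => j _.
by case: (j < i)%N (P i) (Q j) (Q' j) => [] [] [] [].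
Qed.

Lemma xorsumD N P P' : xorsum N (fun i => P i (+) P' i) = xorsum N P (+) xorsum N P'.
Proof. by rewrite /xorsum -big_split. Qed.

Lemma xorsum_delta N k P : (k < N)%N -> xorsum N (fun i => (i == k) && P i) = P k.
Proof.
move=> kN; rewrite /xorsum (bigD1_seq k) ?mem_iota ?subn0 ?iota_uniq //= eqxx.
by rewrite big1 ?addbF // => i /negbTE ->.
Qed.

Lemma xorsum0 N : xorsum N (fun=> false) = false.
Proof. exact: big1. Qed.

Lemma andb_bigaddb (b : bool) N (P : nat -> bool) :
  b && xorsum N P = xorsum N (fun i => b && P i).
Proof. by case: b => //=; rewrite xorsum0. Qed.

Lemma koszul_delta_l N k Q : (k < N)%N -> koszul N (eq_op^~ k) Q = xorsum N (fun j => (j < k)%N && Q j).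
Proof.
move=> kN; rewrite /koszul -[RHS](xorsum_delta (fun i => xorsum N (fun j => (j < i)%N && Q j)) kN).
apply: eq_bigr => i _; rewrite andb_bigaddb; apply: eq_bigr => j _.
by case: (_ == _); rewrite ?andbF.
Qed.

Lemma koszul_delta_r N k P : (k < N)%N -> koszul N P (eq_op^~ k) = xorsum N (fun i => (k < i)%N && P i).
Proof.
move=> kN; apply: eq_bigr => i _.
rewrite -[RHS](xorsum_delta (fun j => (j < i)%N && P i) kN).
by apply: eq_bigr => j _; case: (_ == _); rewrite ?andbF ?andbT.
Qed.

(** The pairs (i, j) split into j < i, i < j and the diagonal. *)
Lemma koszul_swap N P Q :
  koszul N P Q (+) koszul N Q P
  = xorsum N P && xorsum N Q (+) xorsum N (fun i => P i && Q i).
Proof.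
have -> : xorsum N P && xorsum N Q
    = \big[addb/false]_(0 <= i < N) \big[addb/false]_(0 <= j < N) (P i && Q j).
  rewrite andbC andb_bigaddb; apply: eq_bigr => i _.
  by rewrite andbC andb_bigaddb.
rewrite [koszul N Q P]exchange_big /= -big_split /= [in RHS]/xorsum -big_split /=.
apply: eq_big_nat => i /andP[_ iN].
rewrite -big_split /= -[P i && Q i](xorsum_delta (fun j => P i && Q j) iN) -big_split /=.
apply: eq_bigr => j _.
by case: (ltngtP j i) => _; case: (P i) (Q j) => [] [].
Qed.

Definition xb (m : mon) (i : nat) := i \in m.1.
Definition yb (m : mon) (i : nat) := i \in m.2.
Definition pm (m : mon) (i : nat) := pb (bit m i).

(* [koszul (xb m) (yb m)] is the sign between the order x_A y_B of the basis and the
   order x_0 y_0 x_1 y_1 ..., in which the Clifford algebra is a graded tensor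
   product of its rank one pieces. *)
Definition cliff_sgn N (m1 m2 m : mon) : bool :=
  koszul N (pm m1) (pm m2) (+) koszul N (xb m1) (yb m1) (+) koszul N (xb m2) (yb m2)
  (+) koszul N (xb m) (yb m).

Section Local.
Variable K : fieldType.
Implicit Types a b c : bits.

(* The rank one Clifford algebra with yx = t - xy: a pair of bits (a, b) stands for the basis
   element x^a y^b, and [loc u v w] is the coefficient of w in u v. *)
Definition loc0 a b c : K :=
  if [&& ~~ (a.1 && b.1), ~~ (a.2 && b.2) & c == (a.1 || b.1, a.2 || b.2)]
  then (-1) ^+ (a.2 && b.1) else 0.
Definition loc1 a b c : K := ([&& a.2, b.1 & c == (a.1, b.2)])%:R.
Definition loc a b c : {poly K} := (loc0 a b c)%:P + (loc1 a b c)%:P * 'X.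

(* Over int the 256 cases of the local associativity are decided by computation. *)
Let loc0z a b c : int :=
  if [&& ~~ (a.1 && b.1), ~~ (a.2 && b.2) & c == (a.1 || b.1, a.2 || b.2)]
  then (if a.2 && b.1 then -1 else 1) else 0.
Let loc1z a b c : int := if [&& a.2, b.1 & c == (a.1, b.2)] then 1 else 0.

Let sum4 (f : bits -> int) : int :=
  f (false, false) + f (false, true) + f (true, false) + f (true, true).

Lemma loc_assoc a b c d :
  \sum_(z : bits) loc a b z * loc z c d = \sum_(z : bits) loc a z d * loc b c z.
Proof.
have e0 u v w : loc0 u v w = (loc0z u v w)%:~R.
  by rewrite /loc0 /loc0z; case: ifP => // _; case: (_ && _); rewrite ?mulrN1z ?expr1 ?mulr1z.
have e1 u v w : loc1 u v w = (loc1z u v w)%:~R by rewrite /loc1 /loc1z; case: ifP.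
(* The three arguments give the coefficients of 1, X and X^2, so that the identity splits into three
   equalities of integers. *)
pose q (f g h : bits -> int) : {poly K} := ((sum4 f)%:~R : K)%:P
   + ((sum4 g)%:~R : K)%:P * 'X + ((sum4 h)%:~R : K)%:P * 'X ^+ 2.
have E (f0 f1 g0 g1 : bits -> int) : \sum_(z : bits)
    (((f0 z)%:~R : K)%:P + ((f1 z)%:~R : K)%:P * 'X) * (((g0 z)%:~R : K)%:P + ((g1 z)%:~R : K)%:P * 'X)
  = q (fun z => f0 z * g0 z) (fun z => f0 z * g1 z + f1 z * g0 z) (fun z => f1 z * g1 z).
  by rewrite sum_bits /q /sum4 !(intrD, intrM, polyCD, polyCM); ring.
rewrite /loc; under eq_bigr => z _ do rewrite !e0 !e1.
under [RHS]eq_bigr => z _ do rewrite !e0 !e1.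
rewrite !E; congr (_%:~R%:P + _%:~R%:P * _ + _%:~R%:P * _).
all: by move: a b c d => [[] []] [[] []] [[] []] [[] []].
Qed.

Lemma loc_pb a b c : loc a b c != 0 -> pb c = pb a (+) pb b.
Proof.
rewrite /loc /loc0 /loc1.
by move: a b c => [[] []] [[] []] [[] []] //=; rewrite polyC0 mul0r addr0 eqxx.
Qed.

Lemma loc_coef0 a b c : (loc a b c)`_0 = loc0 a b c.
Proof. by rewrite coefD coefC coefMX addr0. Qed.
Lemma loc_coef1 a b c : (loc a b c)`_1 = loc1 a b c.
Proof. by rewrite coefD coefC coefMX coefC add0r. Qed.
Lemma size_loc a b c : (size (loc a b c) <= a.2.+1)%N.
Proof.
rewrite /loc /loc1; case: (a.2) => /=; last by rewrite mul0r addr0 size_polyC leq_b1.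
rewrite (leq_trans (size_polyD _ _)) // geq_max size_polyC (leq_trans (leq_b1 _)) //=.
by rewrite (leq_trans (size_polyMleq _ _)) // size_polyX addn2 size_polyC; case: eqP.
Qed.

Definition locp N (m1 m2 m : mon) : {poly K} :=
  \prod_(0 <= i < N) loc (bit m1 i) (bit m2 i) (bit m i).

Lemma locp_pm N m1 m2 m : locp N m1 m2 m != 0 ->
  forall i, (i < N)%N -> pm m i = pm m1 i (+) pm m2 i.
Proof.
move=> h i iN; apply: loc_pb; apply/negP => /eqP e; case/eqP: h.
by rewrite /locp (bigD1_seq i) ?mem_iota ?subn0 ?iota_uniq //= e mul0r.
Qed.

Definition cliff_cst N m1 m2 m : {poly K} := (-1) ^+ cliff_sgn N m1 m2 m * locp N m1 m2 m.

(** The sign of a nonzero term does not depend on the intermediate monomial [z]: its reordering sign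
    occurs twice, and its parity at each index is the sum of those of its two factors, so that
    [koszul] is additive in it. With the common sign [s] pulled out, the sums factor over the
    indices. *)
Lemma cliff_cst_assoc N m1 m2 m3 m :
  \sum_(z <- mons N) cliff_cst N m1 m2 z * cliff_cst N z m3 m
  = \sum_(z <- mons N) cliff_cst N m1 z m * cliff_cst N m2 m3 z.
Proof.
pose s := koszul N (pm m1) (pm m2) (+) koszul N (pm m1) (pm m3) (+) koszul N (pm m2) (pm m3)
   (+) koszul N (xb m1) (yb m1) (+) koszul N (xb m2) (yb m2) (+) koszul N (xb m3) (yb m3)
   (+) koszul N (xb m) (yb m).
transitivity ((-1) ^+ s * \sum_(z <- mons N)
    \prod_(0 <= i < N) (loc (bit m1 i) (bit m2 i) (bit z i) * loc (bit z i) (bit m3 i) (bit m i))).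
  rewrite mulr_sumr; apply: eq_bigr => z _; rewrite big_split /= -/(locp N m1 m2 z) -/(locp N z m3 m).
  have [e|nz] := eqVneq (locp N m1 m2 z) 0; first by rewrite /cliff_cst e !(mulr0, mul0r).
  rewrite /cliff_cst mulrACA -signr_addb; congr ((-1) ^+ _ * _).
  have e : koszul N (pm z) (pm m3) = koszul N (pm m1) (pm m3) (+) koszul N (pm m2) (pm m3).
    by rewrite -koszulDl; apply: eq_koszul => // i; apply: locp_pm.
  rewrite /cliff_sgn e /s.
  by do 8 (case: (koszul N _ _)).
transitivity ((-1) ^+ s * \sum_(z <- mons N)
    \prod_(0 <= i < N) (loc (bit m1 i) (bit z i) (bit m i) * loc (bit m2 i) (bit m3 i) (bit z i))).
  congr (_ * _).
  rewrite (sum_mons_prod N (fun i b => loc (bit m1 i) (bit m2 i) b * loc b (bit m3 i) (bit m i))).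
  rewrite (sum_mons_prod N (fun i b => loc (bit m1 i) b (bit m i) * loc (bit m2 i) (bit m3 i) b)).
  by apply: eq_bigr => i _; apply: loc_assoc.
rewrite mulr_sumr; apply: eq_bigr => z _; rewrite big_split /= -/(locp N m1 z m) -/(locp N m2 m3 z).
have [e|nz] := eqVneq (locp N m2 m3 z) 0; first by rewrite /cliff_cst e !(mulr0, mul0r).
rewrite /cliff_cst mulrACA -signr_addb; congr ((-1) ^+ _ * _).
have e : koszul N (pm m1) (pm z) = koszul N (pm m1) (pm m2) (+) koszul N (pm m1) (pm m3).
  by rewrite -koszulDr; apply: eq_koszul => // i; apply: locp_pm.
rewrite /cliff_sgn e /s.
by do 8 (case: (koszul N _ _)).
Qed.

Definition cliff_mul N (F G : mon -> {poly K}) (m : mon) : {poly K} :=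
  \sum_(m1 <- mons N) \sum_(m2 <- mons N) cliff_cst N m1 m2 m * (F m1 * G m2).

Lemma cliff_mul_assoc N F G H m : cliff_mul N (cliff_mul N F G) H m = cliff_mul N F (cliff_mul N G H) m.
Proof.
transitivity (\sum_(m1 <- mons N) \sum_(m2 <- mons N) \sum_(m3 <- mons N)
   (\sum_(z <- mons N) cliff_cst N m1 m2 z * cliff_cst N z m3 m) * (F m1 * G m2 * H m3)).
  rewrite /cliff_mul.
  transitivity (\sum_(z <- mons N) \sum_(m3 <- mons N) \sum_(m1 <- mons N) \sum_(m2 <- mons N)
     cliff_cst N m1 m2 z * cliff_cst N z m3 m * (F m1 * G m2 * H m3)).
    apply: eq_bigr => z _; apply: eq_bigr => m3 _.
    rewrite mulr_suml mulr_sumr; apply: eq_bigr => m1 _.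
    rewrite mulr_suml mulr_sumr; apply: eq_bigr => m2 _.
    by rewrite [cliff_cst N m1 m2 z * cliff_cst N z m3 m]mulrC -!mulrA.
  under eq_bigr => z _ do rewrite exchange_big /=.
  rewrite exchange_big /=; apply: eq_bigr => m1 _.
  under eq_bigr => z _ do rewrite exchange_big /=.
  rewrite exchange_big /=; apply: eq_bigr => m2 _.
  by rewrite exchange_big /=; apply: eq_bigr => m3 _; rewrite mulr_suml.
rewrite /cliff_mul; apply: eq_bigr => m1 _.
under eq_bigr => m2 _ do under eq_bigr => m3 _ do rewrite cliff_cst_assoc.
under [RHS]eq_bigr => z _ do (rewrite mulr_sumr mulr_sumr).
rewrite [RHS]exchange_big /=; apply: eq_bigr => m2 _.
under [RHS]eq_bigr => z _ do (rewrite mulr_sumr mulr_sumr).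
rewrite [RHS]exchange_big /=; apply: eq_bigr => m3 _.
rewrite mulr_suml; apply: eq_bigr => z _.
by ring.
Qed.
End Local.

Lemma belowE N A : below N A = (barS A <= N)%N.
Proof.
apply/belowP/idP => [h|h i iA].
  by apply/bigmax_leqP_seq => i iA _; apply: h.
by apply: leq_trans h; exact: (leq_bigmax_seq (F := fun i => i.+1)).
Qed.

Definition Nof (m : mon) := maxn (barS m.1) (barS m.2).

Lemma belowmE N m : belowm N m = (Nof m <= N)%N.
Proof. by rewrite /belowm !belowE geq_max. Qed.

Lemma ltn_barS i (A : {fset nat}) : i \in A -> (i < barS A)%N.
Proof. by move=> iA; exact: (leq_bigmax_seq (F := fun i => i.+1)). Qed.

(* H~ is the case c = 0; the monomials x_s with s below c are admitted for the sake of the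
   generators x_i, which do not belong to H~. *)
Definition xbound (R : nmodType) (c : nat) (F : mon -> R) : Prop :=
  forall m, F m != 0 -> (barS m.1 <= c)%N || (barS m.1 < barS m.2)%N.

Lemma koszul_le N N' P Q : (N <= N')%N -> (forall i, (N <= i)%N -> P i = false) ->
  (forall i, (N <= i)%N -> Q i = false) -> koszul N' P Q = koszul N P Q.
Proof.
move=> le hP hQ; rewrite /koszul (big_cat_nat _ (n := N)) //=.
rewrite [X in _ (+) X]big_nat_cond [X in _ (+) X]big1 ?addbF; last first.
  move=> i /andP[/andP[/hP e _] _]; rewrite big1 // => j _; by rewrite e andbF.
apply: eq_bigr => i _; rewrite (big_cat_nat _ (n := N)) //=.
rewrite [X in _ (+) X]big_nat_cond [X in _ (+) X]big1 ?addbF //.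
by move=> j /andP[/andP[/hQ -> _] _]; rewrite !andbF.
Qed.

(** * Independence of the truncation bound, and stability of the support condition *)

Section Stable.
Variable K : fieldType.

(** Without an x at this index nothing can be contracted, and two letters y would give y^2 = 0. *)
Lemma loc_top a2 b2 c : ~~ [&& ~~ a2 & ~~ b2] -> loc K (false, a2) (false, b2) c != 0 ->
  c = (false, true).
Proof.
rewrite /loc /loc0 /loc1 /= andbF mul0r addr0.
by case: a2 b2 c => [] [] // [[] []] //=; rewrite eqxx.
Qed.

Lemma loc_00 c : loc K (false, false) (false, false) c = (c == (false, false))%:R.
Proof. by rewrite /loc /loc0 /loc1 /= mul0r addr0; case: (c == _). Qed.

Lemma locp_loc N m1 m2 m i : (i < N)%N -> locp K N m1 m2 m != 0 ->
  loc K (bit m1 i) (bit m2 i) (bit m i) != 0.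
Proof.
move=> iN; apply: contra_neq => e.
by rewrite /locp (bigD1_seq i) ?mem_iota ?subn0 ?iota_uniq //= e mul0r.
Qed.

Lemma bit_top c k m : (c <= k)%N -> (Nof m <= k.+1)%N ->
  (barS m.1 <= c)%N || (barS m.1 < barS m.2)%N -> (k \in m.1) = false.
Proof.
move=> ck; rewrite geq_max => /andP[h1 h2] h; apply/negP => /ltn_barS.
by move: ck h1 h2 h; lia.
Qed.

(* The largest index occurring in m1 or m2 is, above c, the index of a single y,
   and no contraction can remove it. *)
Lemma top_index N c m1 m2 m : belowm N m1 -> belowm N m2 -> belowm N m ->
  (barS m1.1 <= c)%N || (barS m1.1 < barS m1.2)%N ->
  (barS m2.1 <= c)%N || (barS m2.1 < barS m2.2)%N ->
  locp K N m1 m2 m != 0 ->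
  let T := maxn (Nof m1) (Nof m2) in
  belowm T m /\ ((T <= c)%N \/ (T.-1 \in m.2 /\ (barS m.1 <= T.-1 /\ T = T.-1.+1)%N)).
Proof.
move=> b1 b2 b h1 h2 nz T.
have TN : (T <= N)%N by rewrite geq_max -!belowmE b1 b2.
have bT i : (T <= i)%N -> bit m i = (false, false).
  move=> Ti; have [Ni|iN] := leqP N i; first exact: bit_ge Ni.
  have := locp_loc iN nz.
  rewrite (@bit_ge T m1 i) // ?(@bit_ge T m2 i) // ?belowmE ?leq_maxl ?leq_maxr //.
  by rewrite loc_00; case: (bit m i =P _) => // _; rewrite eqxx.
have bmT : belowm T m.
  apply/andP; split; apply/belowP => i iA; rewrite ltnNge; apply/negP => /bT [].
    by rewrite iA.
  by rewrite iA.
split=> //; have [|cT] := leqP T c; [by left|right].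
have eT : T = T.-1.+1 by rewrite prednK //; apply: leq_trans cT.
have ck : (c <= T.-1)%N by rewrite -ltnS -eT.
have kN : (T.-1 < N)%N by rewrite -eT.
have x1 := bit_top ck (m := m1) ltac:(by rewrite -eT leq_maxl) h1.
have x2 := bit_top ck (m := m2) ltac:(by rewrite -eT leq_maxr) h2.
have := locp_loc kN nz; rewrite /bit x1 x2 => /loc_top H.
have /H [mx my] : ~~ (~~ (T.-1 \in m1.2) && ~~ (T.-1 \in m2.2)).
  apply/negP => /andP[y1 y2].
  have A (M : mon) : (Nof M <= T)%N -> (T.-1 \in M.1) = false -> T.-1 \notin M.2 ->
     (Nof M <= T.-1)%N.
    rewrite -!belowmE => /andP[/belowP a /belowP a'] nx ny.
    apply/andP; split; apply/belowP => i iM.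
      have := a i iM; rewrite {1}eT ltnS leq_eqVlt => /predU1P[ei|//].
      by rewrite -ei iM in nx.
    have := a' i iM; rewrite {1}eT ltnS leq_eqVlt => /predU1P[ei|//].
    by rewrite -ei iM in ny.
  have := A m1 (leq_maxl _ _) x1 y1; have := A m2 (leq_maxr _ _) x2 y2.
  by move=> l2 l1; have : (T <= T.-1)%N by [rewrite geq_max l1 l2]; rewrite {1}eT ltnn.
split; [by rewrite my|split=> //].
rewrite -belowE; apply/belowP => i iM.
case/andP: bmT => /belowP /(_ i iM); rewrite {1}eT ltnS leq_eqVlt => /predU1P[ei|//] _.
by rewrite -ei iM in mx.
Qed.

Lemma bits_ge N m i : belowm N m -> (N <= i)%N ->
  [/\ xb m i = false, yb m i = false & pm m i = false].
Proof. by move=> b le; move: (bit_ge b le); rewrite /pm => -> ; case: (bit_ge b le). Qed.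

Lemma cliff_cst_le N N' m1 m2 m : (N <= N')%N -> belowm N m1 -> belowm N m2 -> belowm N m ->
  cliff_cst K N' m1 m2 m = cliff_cst K N m1 m2 m.
Proof.
move=> le b1 b2 b; rewrite /cliff_cst; congr ((-1) ^+ _ * _).
  rewrite /cliff_sgn !(@koszul_le N N') // => i;
  first [by move/(bits_ge b1) => [] | by move/(bits_ge b2) => [] | by move/(bits_ge b) => []].
rewrite /locp (big_cat_nat _ (n := N)) //= [X in _ * X]big_nat_cond [X in _ * X]big1 ?mulr1 //.
by move=> i /andP[/andP[Ni _] _]; rewrite !(bit_ge _ Ni) // loc_00 eqxx.
Qed.

Lemma sum_mons_narrow (R : nmodType) N N' (f : mon -> R) : (N <= N')%N ->
  (forall m, belowm N' m -> f m != 0 -> belowm N m) ->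
  \sum_(m <- mons N') f m = \sum_(m <- mons N) f m.
Proof.
move=> le h; rewrite (bigID (belowm N)) /= [X in _ + X]big_seq_cond [X in _ + X]big1; last first.
  move=> m /andP[]; rewrite mem_mons => bm nb; apply/eqP; apply: contraNT nb => /h; exact.
rewrite addr0 -big_filter; apply: perm_big; apply: uniq_perm; rewrite ?filter_uniq ?uniq_mons //.
move=> m; rewrite mem_filter !mem_mons; case: (boolP (belowm N m)) => //= /belowm_le; exact.
Qed.

Lemma mulf3_neq0 (R : idomainType) (a b c : R) :
  a * (b * c) != 0 -> [/\ a != 0, b != 0 & c != 0].
Proof. by rewrite !mulf_eq0 !negb_or => /and3P[]. Qed.

(** This is the convergence of the product: by [top_index] the largest index of a contributing pair
    either is below c or survives in [m], hence it is below [N]. *)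
Lemma cliff_mul_stable N N' c (F G : mon -> {poly K}) m :
  xbound c F -> xbound c G -> (c <= N)%N -> (N <= N')%N -> belowm N m ->
  cliff_mul N' F G m = cliff_mul N F G m.
Proof.
move=> hF hG cN le b.
have key m1 m2 : belowm N' m1 -> belowm N' m2 -> cliff_cst K N' m1 m2 m * (F m1 * G m2) != 0 ->
    belowm N m1 && belowm N m2.
  move=> b1 b2 /mulf3_neq0[ns /hF h1 /hG h2].
  have nl : locp K N' m1 m2 m != 0 by apply: contraNneq ns => e; rewrite /cliff_cst e mulr0.
  have [_] := top_index b1 b2 (belowm_le le b) h1 h2 nl.
  set T := maxn _ _ => H; have TN : (T <= N)%N.
    case: H => [/leq_trans|[km [_ eT]]]; first exact.
    by rewrite eT; case/andP: b => _ /belowP; apply.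
  by rewrite !belowmE !(leq_trans _ TN) // (leq_maxl, leq_maxr).
rewrite /cliff_mul (sum_mons_narrow le); last first.
  move=> m1 b1; apply: contraNT => nb; rewrite big_seq big1 // => m2; rewrite mem_mons => b2.
  by apply/eqP; apply: contraNT nb => /(key _ _ b1 b2)/andP[].
apply: eq_big_seq => m1; rewrite mem_mons => b1.
rewrite (sum_mons_narrow le); last first.
  by move=> m2 b2 /(key _ _ (belowm_le le b1) b2)/andP[].
by apply: eq_big_seq => m2; rewrite mem_mons => b2; rewrite (cliff_cst_le le).
Qed.

Lemma sum_neq0 (R : nmodType) (I : eqType) (r : seq I) (f : I -> R) :
  \sum_(i <- r) f i != 0 -> exists2 i, i \in r & f i != 0.
Proof.
move=> h; apply: contrapT => H; case/eqP: h; rewrite big_seq big1 // => i ir.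
by apply/eqP/negPn/negP => nz; apply: H; exists i.
Qed.

Lemma cliff_mul_neq0 N (F G : mon -> {poly K}) m : cliff_mul N F G m != 0 ->
  exists m1 m2, [/\ belowm N m1, belowm N m2, locp K N m1 m2 m != 0, F m1 != 0 & G m2 != 0].
Proof.
move=> /sum_neq0[m1]; rewrite mem_mons => b1 /sum_neq0[m2]; rewrite mem_mons => b2.
move=> /mulf3_neq0[ns nF nG]; exists m1, m2; split=> //.
by apply: contraNneq ns => e; rewrite /cliff_cst e mulr0.
Qed.

Lemma cliff_mul_xbound N c (F G : mon -> {poly K}) m : xbound c F -> xbound c G -> belowm N m ->
  cliff_mul N F G m != 0 -> (barS m.1 <= c)%N || (barS m.1 < barS m.2)%N.
Proof.
move=> hF hG b /cliff_mul_neq0[m1 [m2 [b1 b2 nl /hF h1 /hG h2]]].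
have [bT [Tc|[km [bk _]]]] := top_index b1 b2 b h1 h2 nl.
  by case/andP: bT; rewrite belowE => /leq_trans/(_ Tc) ->.
by rewrite (leq_ltn_trans bk (ltn_barS km)) orbT.
Qed.

End Stable.

(** * The star product on series *)

Section Star.
Variable K : fieldType.
Implicit Types (f g h : ser K) (C D E : tser K).

Definition cpoly f : mon -> {poly K} := fun m => (f m)%:P.
(** A [tser] is an arbitrary coefficient sequence, not a polynomial; the coefficient of t^n in a
    product only sees the terms up to t^n. *)
Definition tpoly n C : mon -> {poly K} := fun m => \poly_(k < n.+1) C k m.

(* On series satisfying [xbound c], truncating at the indices below max(c, Nof m) does not change
   the coefficient at m. *)
Definition starc c r f g : ser K :=
  fun m => (cliff_mul (maxn c (Nof m)) (cpoly f) (cpoly g) m)`_r.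
Definition star c C D : tser K :=
  fun n m => (cliff_mul (maxn c (Nof m)) (tpoly n C) (tpoly n D) m)`_n.

Lemma coef_cliff_mul N f g m r : (cliff_mul N (cpoly f) (cpoly g) m)`_r =
  \sum_(m1 <- mons N) \sum_(m2 <- mons N)
     (-1) ^+ cliff_sgn N m1 m2 m * (locp K N m1 m2 m)`_r * (f m1 * g m2).
Proof.
rewrite coef_sum; apply: eq_bigr => m1 _; rewrite coef_sum; apply: eq_bigr => m2 _.
by rewrite /cliff_cst -polyCM mulrC coefCM -signr_odd oddb -polyC1 -polyCN -polyC_exp coefCM mulrC.
Qed.

(** Multiplication respects congruence modulo t^(n+1); this allows a factor to be replaced by any
    other one with the same low coefficients. *)
Lemma cliff_mul_trunc n N (F F' G G' : mon -> {poly K}) m :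
  (forall m1 k, belowm N m1 -> (k <= n)%N -> (F m1)`_k = (F' m1)`_k) ->
  (forall m1 k, belowm N m1 -> (k <= n)%N -> (G m1)`_k = (G' m1)`_k) ->
  forall k, (k <= n)%N -> (cliff_mul N F G m)`_k = (cliff_mul N F' G' m)`_k.
Proof.
have M (p p' q q' : {poly K}) : (forall k, (k <= n)%N -> p`_k = p'`_k) ->
  (forall k, (k <= n)%N -> q`_k = q'`_k) -> forall k, (k <= n)%N -> (p * q)`_k = (p' * q')`_k.
  move=> hp hq k kn; rewrite !coefM; apply: eq_bigr => i _; rewrite hp ?hq //.
    by rewrite (leq_trans (leq_subr _ _)).
  by rewrite (leq_trans _ kn) // -ltnS.
move=> hF hG k kn; rewrite !coef_sum; apply: eq_big_seq => m1; rewrite mem_mons => b1.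
rewrite !coef_sum; apply: eq_big_seq => m2; rewrite mem_mons => b2.
by apply: (M) => // k' k'n; apply: (M) => // l ln; [apply: hF|apply: hG].
Qed.

Lemma coef_tpoly n C m k : (k <= n)%N -> (tpoly n C m)`_k = C k m.
Proof. by move=> kn; rewrite coef_poly ltnS kn. Qed.

Lemma xbound_tpoly c n C : (forall k, xbound c (C k)) -> xbound c (tpoly n C).
Proof.
move=> h m; apply: contraNT => nh; apply/eqP/polyP => k; rewrite coef_poly coef0.
by case: ifP => // _; apply/eqP; apply: contraNT nh => /h.
Qed.

(** The inner product at [m1] is computed with an index bound depending on [m1] and a truncation
    depending on the power of t. [cliff_mul_stable] raises all index bounds to one [N],
    [cliff_mul_trunc] aligns the truncations, and the finite associativity applies. *)
Lemma star_assoc c C D E :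
  (forall k, xbound c (C k)) -> (forall k, xbound c (D k)) -> (forall k, xbound c (E k)) ->
  star c (star c C D) E = star c C (star c D E).
Proof.
move=> hC hD hE; apply/funext => n; apply/funext => m; rewrite /star.
set N := maxn c (Nof m); have cN : (c <= N)%N by exact: leq_maxl.
have key (C' D' : tser K) m1 k : (forall k, xbound c (C' k)) -> (forall k, xbound c (D' k)) ->
    belowm N m1 -> (k <= n)%N ->
    (tpoly n (fun n m => (cliff_mul (maxn c (Nof m)) (tpoly n C') (tpoly n D') m)`_n) m1)`_k
    = (cliff_mul N (tpoly n C') (tpoly n D') m1)`_k.
  move=> hC' hD' b1 kn; rewrite coef_tpoly //.
  have le : (maxn c (Nof m1) <= N)%N by rewrite geq_max cN -belowmE.
  rewrite -(cliff_mul_stable (xbound_tpoly (n := k) hC') (xbound_tpoly (n := k) hD') (leq_maxl _ _) le); last first.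
    by rewrite belowmE leq_maxr.
  by apply: (cliff_mul_trunc (n := k)) => // m2 l _ lk; rewrite !coef_tpoly // (leq_trans lk).
rewrite (cliff_mul_trunc (n := n) (F' := cliff_mul N (tpoly n C) (tpoly n D)) (G' := tpoly n E)) //; last first.
  by move=> m1 k; apply: key.
rewrite cliff_mul_assoc; symmetry; apply: (cliff_mul_trunc (n := n)) => // m1 k; exact: key.
Qed.

Lemma star_xbound c C D n : (forall k, xbound c (C k)) -> (forall k, xbound c (D k)) -> xbound c (star c C D n).
Proof.
move=> hC hD m nz; apply: (cliff_mul_xbound (xbound_tpoly (n := n) hC) (xbound_tpoly (n := n) hD) (N := maxn c (Nof m))).
  by rewrite belowmE leq_maxr.
by apply: contraNneq nz => e; rewrite /star e coef0.
Qed.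

Lemma starE c C D n m : star c C D n m =
  \sum_(k < n.+1) \sum_(l < n.+1 | (k + l <= n)%N) starc c (n - (k + l)) (C k) (D l) m.
Proof.
rewrite /star; set N := maxn _ _.
have -> : cliff_mul N (tpoly n C) (tpoly n D) m
    = \sum_(k < n.+1) \sum_(l < n.+1) 'X^(k + l) * cliff_mul N (cpoly (C k)) (cpoly (D l)) m.
  rewrite /cliff_mul.
  under [RHS]eq_bigr => k _ do under eq_bigr => l _ do rewrite mulr_sumr.
  under [RHS]eq_bigr => k _ do rewrite exchange_big /=.
  rewrite [RHS]exchange_big /=; apply: eq_bigr => m1 _.
  under [RHS]eq_bigr => k _ do under eq_bigr => l _ do rewrite mulr_sumr.
  under [RHS]eq_bigr => k _ do rewrite exchange_big /=.
  rewrite [RHS]exchange_big /=; apply: eq_bigr => m2 _.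
  rewrite /tpoly !poly_def mulr_suml mulr_sumr; apply: eq_bigr => k _.
  rewrite mulr_sumr mulr_sumr; apply: eq_bigr => l _.
  by rewrite exprD /cpoly -!mul_polyC; ring.
rewrite coef_sum; apply: eq_bigr => k _; rewrite coef_sum [RHS]big_mkcond /=.
apply: eq_bigr => l _; rewrite coefXnM ltnNge; by case: leqP.
Qed.

Lemma starc_zerol c r g : starc c r (zeroS K) g = zeroS K.
Proof.
apply/funext => m; rewrite /starc coef_cliff_mul big1 // => m1 _; rewrite big1 // => m2 _.
by rewrite mul0r mulr0.
Qed.
Lemma starc_zeror c r f : starc c r f (zeroS K) = zeroS K.
Proof.
apply/funext => m; rewrite /starc coef_cliff_mul big1 // => m1 _; rewrite big1 // => m2 _.
by rewrite !mulr0.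
Qed.

Lemma star_constr c C g n m :
  star c C (constT g) n m = \sum_(k < n.+1) starc c (n - k) (C k) g m.
Proof.
rewrite starE; apply: eq_bigr => k _; rewrite big_mkcond big_ord_recl /= addn0 -ltnS ltn_ord.
by rewrite big1 ?addr0 // => i _; rewrite starc_zeror; case: ifP.
Qed.

Lemma star_constl c f D n m :
  star c (constT f) D n m = \sum_(k < n.+1) starc c (n - k) f (D k) m.
Proof.
rewrite starE big_ord_recl /= [X in _ + X]big1 ?addr0; last first.
  by move=> i _; rewrite big1 // => j _; rewrite starc_zerol.
by apply: eq_bigl => k; rewrite add0n -ltnS ltn_ord.
Qed.

Lemma star_const c f g : star c (constT f) (constT g) = fun r => starc c r f g.
Proof.
apply/funext => n; apply/funext => m; rewrite star_constr big_ord_recl /= subn0.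
by rewrite big1 ?addr0 // => i _; rewrite starc_zerol.
Qed.

Lemma xbound0 c : xbound c (zeroS K).
Proof. by move=> m; rewrite eqxx. Qed.

Lemma xbound_const c f k : xbound c f -> xbound c (constT f k).
Proof. by case: k => //= k _; exact: xbound0. Qed.

(** Associativity on constants, at order t^n. Its cases n = 1 and n = 2 yield [contr_assoc] and
    [contr_comp]. *)
Lemma starc_assoc c n f g h m : xbound c f -> xbound c g -> xbound c h ->
  \sum_(k < n.+1) starc c (n - k) (starc c k f g) h m
  = \sum_(k < n.+1) starc c (n - k) f (starc c k g h) m.
Proof.
move=> hf hg hh; rewrite -(star_constr c (fun k => starc c k f g)) -(star_constl c f (fun k => starc c k g h)) -!star_const.
by rewrite star_assoc // => k; exact: xbound_const.
Qed.

Lemma starc_xbound c r f g : xbound c f -> xbound c g -> xbound c (starc c r f g).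
Proof.
by move=> hf hg; rewrite -[starc c r f g]/((fun r => starc c r f g) r) -star_const;
   apply: star_xbound => k; apply: xbound_const.
Qed.

Lemma starcDl c r f f' g : starc c r (addS f f') g = addS (starc c r f g) (starc c r f' g).
Proof.
apply/funext => m; rewrite /addS /starc !coef_cliff_mul -big_split; apply: eq_bigr => m1 _ /=.
by rewrite -big_split; apply: eq_bigr => m2 _; rewrite /= mulrDl mulrDr.
Qed.
Lemma starcDr c r f g g' : starc c r f (addS g g') = addS (starc c r f g) (starc c r f g').
Proof.
apply/funext => m; rewrite /addS /starc !coef_cliff_mul -big_split; apply: eq_bigr => m1 _ /=.
by rewrite -big_split; apply: eq_bigr => m2 _; rewrite /= mulrDr mulrDr.
Qed.
Lemma starcZl c r (k : K) f g : starc c r (scaleS k f) g = scaleS k (starc c r f g).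
Proof.
apply/funext => m; rewrite /scaleS /starc !coef_cliff_mul mulr_sumr; apply: eq_bigr => m1 _ /=.
rewrite mulr_sumr; apply: eq_bigr => m2 _; by ring.
Qed.
Lemma starcZr c r (k : K) f g : starc c r f (scaleS k g) = scaleS k (starc c r f g).
Proof.
apply/funext => m; rewrite /scaleS /starc !coef_cliff_mul mulr_sumr; apply: eq_bigr => m1 _ /=.
rewrite mulr_sumr; apply: eq_bigr => m2 _; by ring.
Qed.

Lemma size_locp N m1 m2 m : belowm N m1 -> (size (locp K N m1 m2 m) <= #|` m1.2|.+1)%N.
Proof.
move=> b.
have H n : (size (locp K n m1 m2 m) <= (\sum_(0 <= i < n) (i \in m1.2)).+1)%N.
  rewrite /locp; elim: n => [|n IH]; first by rewrite !big_geq // size_poly1.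
  rewrite !big_nat_recr //=; apply: leq_trans (size_polyMleq _ _) _.
  by have := size_loc K (bit m1 n) (bit m2 n) (bit m n); move: IH => /=; lia.
apply: leq_trans (H N) _; rewrite ltnS.
rewrite -big_mkcond /= sum1_count -size_filter.
apply: uniq_leq_size; first by rewrite filter_uniq ?iota_uniq.
by move=> i; rewrite mem_filter => /andP[].
Qed.

(** Every contraction consumes a y of the left factor, so at most d of them are possible. *)
Lemma starc_big c r d f g : (forall m, f m != 0 -> (#|` m.2| <= d)%N) -> (d < r)%N ->
  starc c r f g = zeroS K.
Proof.
move=> hf dr; apply/funext => m; rewrite /starc coef_cliff_mul big_seq big1 // => m1.
rewrite mem_mons => b1; rewrite big1 // => m2 _.
have [->|/hf h1] := eqVneq (f m1) 0; first by rewrite mul0r mulr0.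
rewrite [_`_r]nth_default ?mulr0 ?mul0r //.
by apply: leq_trans (size_locp _ _ b1) _; apply: leq_ltn_trans dr.
Qed.

End Star.

(** * The orders t^0 and t^1 *)

Lemma big_fset_nat (R : Type) (idx : R) (op : Monoid.com_law idx) N (A : {fset nat}) (F : nat -> R) :
  below N A -> \big[op/idx]_(i <- A) F i = \big[op/idx]_(0 <= i < N | i \in A) F i.
Proof.
move=> /belowP h; rewrite -[RHS]big_filter; apply: perm_big; apply: uniq_perm.
- exact: fset_uniq.
- by rewrite filter_uniq ?iota_uniq.
- move=> i; rewrite mem_filter mem_iota subn0 add0n /=.
  by case: (boolP (i \in A)) => //= /h ->.
Qed.

Lemma odd_count N (A : {fset nat}) (a : pred nat) : below N A ->
  odd (count a A) = xorsum N (fun i => a i && (i \in A)).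
Proof.
move=> h; rewrite -sum1_count big_mkcond (big_morph odd oddD (erefl : odd 0 = false)).
rewrite (big_fset_nat _ _ h) big_mkcond; apply: eq_bigr => i _.
by case: (i \in A) (a i) => [] [].
Qed.

Lemma odd_card N (A : {fset nat}) : below N A -> odd #|` A| = xorsum N (fun i => i \in A).
Proof. by move=> h; rewrite -count_predT (odd_count _ h). Qed.

Lemma odd_ninv N (S T : {fset nat}) : below N S -> below N T ->
  odd (ninv S T) = koszul N (fun i => i \in S) (fun i => i \in T).
Proof.
move=> hS hT; rewrite /ninv (big_morph odd oddD (erefl : odd 0 = false)).
rewrite (big_fset_nat _ _ hS) big_mkcond; apply: eq_bigr => i _.
case: (i \in S); last by rewrite big1 // => j _; rewrite andbF.
rewrite (big_morph odd oddD (erefl : odd 0 = false)) (big_fset_nat _ _ hT) big_mkcond.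
by apply: eq_bigr => j _; rewrite oddb; case: (j \in T); rewrite ?andbT ?andbF.
Qed.

Lemma parityE N m : belowm N m -> parity m = xorsum N (pm m).
Proof.
move=> /andP[b1 b2]; rewrite /parity oddD (odd_card b1) (odd_card b2) -xorsumD.
by apply: eq_xorsum.
Qed.

Section Order01.
Variable K : fieldType.
Implicit Types (f g h : ser K).

Definition locp0 N m1 m2 m : K := \prod_(0 <= i < N) loc0 K (bit m1 i) (bit m2 i) (bit m i).

Lemma locp_coef0 N m1 m2 m : (locp K N m1 m2 m)`_0 = locp0 N m1 m2 m.
Proof.
rewrite /locp /locp0; elim: N => [|N IH]; first by rewrite !big_geq // coefC.
by rewrite !big_nat_recr //= coef0M IH loc_coef0.
Qed.

Lemma prod_sign_if (c b : nat -> bool) N :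
  \prod_(0 <= i < N) (if c i then (-1) ^+ b i else 0 : K)
  = if all c (iota 0 N) then (-1) ^+ xorsum N b else 0.
Proof.
elim: N => [|N IH]; first by rewrite /xorsum !big_geq.
have -> : all c (iota 0 N.+1) = all c (iota 0 N) && c N.
  by rewrite -(addn1 N) iotaD all_cat /= andbT.
rewrite /xorsum !big_nat_recr //= IH.
case: (all _ _); last by rewrite mul0r.
by case: (c N); rewrite ?mulr0 // signr_addb.
Qed.

(** A nonzero factor at every index says that [m] is the disjoint union of [m1] and [m2]. The
    remaining sign comes from moving y_i past x_i at the same index; crossings of different indices
    are counted in [cliff_sgn]. *)
Lemma locp0E N m1 m2 m : belowm N m1 -> belowm N m2 -> belowm N m ->
  locp0 N m1 m2 m = if [&& m1.1 `<=` m.1, m1.2 `<=` m.2 & m2 == (m.1 `\` m1.1, m.2 `\` m1.2)]%fset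
                 then (-1) ^+ xorsum N (fun i => yb m1 i && xb m2 i) else 0.
Proof.
move=> b1 b2 b; rewrite /locp0 /loc0 prod_sign_if.
suff -> : all (fun i => [&& ~~ ((bit m1 i).1 && (bit m2 i).1), ~~ ((bit m1 i).2 && (bit m2 i).2) &
     bit m i == ((bit m1 i).1 || (bit m2 i).1, (bit m1 i).2 || (bit m2 i).2)]) (iota 0 N)
   = [&& m1.1 `<=` m.1, m1.2 `<=` m.2 & m2 == (m.1 `\` m1.1, m.2 `\` m1.2)]%fset by [].
apply/allP/and3P => [H|[/fsubsetP s1 /fsubsetP s2 /eqP e] i _].
  have {}H i : [&& ~~ ((bit m1 i).1 && (bit m2 i).1), ~~ ((bit m1 i).2 && (bit m2 i).2) &
     bit m i == ((bit m1 i).1 || (bit m2 i).1, (bit m1 i).2 || (bit m2 i).2)].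
    have [iN|Ni] := ltnP i N; first by apply: H; rewrite mem_iota.
    by rewrite !(bit_ge _ Ni).
  split.
  - by apply/fsubsetP => i i1; have /and3P[_ _ /eqP[-> _]] := H i; rewrite i1.
  - by apply/fsubsetP => i i1; have /and3P[_ _ /eqP[_ ->]] := H i; rewrite i1.
  case: m2 b2 H => A B b2 H; apply/eqP; congr (_, _); apply/fsetP => i.
    by have /and3P[n1 _ /eqP[+ _]] := H i; rewrite !inE => ->; move: n1; rewrite /=;
       case: (i \in m1.1) (i \in A) => [] [].
  by have /and3P[_ n1 /eqP[_ +]] := H i; rewrite !inE => ->; move: n1; rewrite /=;
     case: (i \in m1.2) (i \in B) => [] [].
rewrite e /bit /= !inE xpair_eqE.
have := s1 i; have := s2 i.
case: (i \in m1.1) (i \in m1.2) (i \in m.1) (i \in m.2) => [] [] [] [] //= p q;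
  by [have := p isT|have := q isT].
Qed.

Lemma sum_fpowerset (R : nmodType) N (S : {fset nat}) (phi : {fset nat} -> R) : below N S ->
  \sum_(A <- fpowerset S) phi A = \sum_(A <- subs N | (A `<=` S)%fset) phi A.
Proof.
move=> /belowP h; rewrite -[RHS]big_filter; apply: perm_big; apply: uniq_perm.
- exact: fset_uniq.
- by rewrite filter_uniq ?uniq_subs.
move=> A; rewrite mem_filter fpowersetE mem_subs; case: (boolP (A `<=` S)%fset) => //= /fsubsetP s.
by apply/esym/belowP => i /s /h.
Qed.

Lemma mulSE N f g m : belowm N m -> mulS f g m =
  \sum_(m1 <- mons N) \sum_(m2 <- mons N) (-1) ^+ cliff_sgn N m1 m2 m * locp0 N m1 m2 m * (f m1 * g m2).
Proof.
move=> b; case/andP: (b) => bx byy.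
rewrite /mulS (sum_fpowerset _ bx) big_mkcond /mons big_allpairs.
apply: eq_big_seq => A1; rewrite mem_subs => bA.
have -> : (if (A1 `<=` m.1)%fset then \sum_(contr <- fpowerset m.2)
      sgnM K (A1, contr) (m.1 `\` A1, m.2 `\` contr)%fset * f (A1, contr) * g (m.1 `\` A1, m.2 `\` contr)%fset
      else 0) = \sum_(contr <- subs N) (if (A1 `<=` m.1)%fset && (contr `<=` m.2)%fset then
      sgnM K (A1, contr) (m.1 `\` A1, m.2 `\` contr)%fset * f (A1, contr) * g (m.1 `\` A1, m.2 `\` contr)%fset
      else 0).
  case: (A1 `<=` m.1)%fset => /=; last by rewrite big1.
  by rewrite (sum_fpowerset _ byy) big_mkcond.
apply: eq_big_seq => contr; rewrite mem_subs => bB.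
rewrite -/(mons N).
have b1 : belowm N (A1, contr) by rewrite /belowm bA bB.
case: ifP => [/andP[sA sB]|ns]; last first.
  rewrite big_seq big1 // => m2; rewrite mem_mons => b2.
  by rewrite (locp0E b1 b2 b) /= andbA ns mulr0 mul0r.
set m2 := (m.1 `\` A1, m.2 `\` contr)%fset.
have b2 : belowm N m2.
  by apply/andP; split; apply/belowP => i; rewrite !inE => /andP[_]; [move/belowP: bx|move/belowP: byy]; apply.
rewrite (bigD1_seq m2) ?mem_mons ?uniq_mons //= [X in _ + X]big_seq_cond [X in _ + X]big1 ?addr0.
  rewrite (locp0E b1 b2 b) /= sA sB eqxx /= -signr_addb mulrA; congr (_ * _ * _).
  rewrite /sgnM -signr_odd /= !oddD oddM (odd_card bB) (odd_card (proj1 (andP b2))).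
  rewrite (odd_ninv bA (proj1 (andP b2))) (odd_ninv bB (proj2 (andP b2))).
  have ex : {in gtn N, xb m =1 fun i => xb (A1, contr) i (+) xb m2 i}.
    move=> i _; rewrite /xb /= !inE; have := fsubsetP sA i.
    by case: (i \in A1) (i \in m.1) => [] [] // /(_ isT).
  have ey : {in gtn N, yb m =1 fun i => yb (A1, contr) i (+) yb m2 i}.
    move=> i _; rewrite /yb /= !inE; have := fsubsetP sB i.
    by case: (i \in contr) (i \in m.2) => [] [] // /(_ isT).
  rewrite /cliff_sgn (eq_koszul ex ey).
  have -> : koszul N (pm (A1, contr)) (pm m2) = koszul N (xb (A1,contr)) (xb m2) (+) koszul N (xb (A1,contr)) (yb m2)
     (+) (koszul N (yb (A1,contr)) (xb m2) (+) koszul N (yb (A1,contr)) (yb m2)).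
    by rewrite -!koszulDr -koszulDl.
  rewrite !koszulDl !koszulDr.
  (* [sgnM] counts all pairs of a y on the left and an x on the right: those with either order of
     indices, and the diagonal, which is the sign of [locp0]. *)
  have sw := koszul_swap N (yb (A1, contr)) (xb m2).
  have -> : xorsum N (fun i => i \in contr) && xorsum N (fun i => i \in (m.1 `\` A1)%fset)
     = koszul N (yb (A1, contr)) (xb m2) (+) koszul N (xb m2) (yb (A1, contr))
       (+) xorsum N (fun i => yb (A1, contr) i && xb m2 i).
    by rewrite sw addbK.
  rewrite -[koszul N (in_mem^~ (mem A1)) _]/(koszul N (xb (A1, contr)) (xb m2)).
  rewrite -[koszul N (in_mem^~ (mem contr)) _]/(koszul N (yb (A1, contr)) (yb m2)).
  move: (koszul N (xb (A1, contr)) (xb m2)) (koszul N (xb (A1, contr)) (yb m2)) (koszul N (yb (A1, contr)) (xb m2))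
    (koszul N (yb (A1, contr)) (yb m2)) (koszul N (xb (A1, contr)) (yb (A1,contr))) (koszul N (xb m2) (yb m2))
    (koszul N (xb m2) (yb (A1,contr))) (xorsum _ _).
  by do 8 case.
move=> m' /andP[]; rewrite mem_mons => b' ne.
by rewrite (locp0E b1 b' b) /= (negbTE ne) !andbF mulr0 mul0r.
Qed.

Lemma starc0 c f g : starc c 0 f g = mulS f g.
Proof.
apply/funext => m; rewrite /starc coef_cliff_mul (@mulSE (maxn c (Nof m))) ?belowmE ?leq_maxr //.
by apply: eq_bigr => m1 _; apply: eq_bigr => m2 _; rewrite locp_coef0.
Qed.

Lemma locp0_swap N m1 m2 m :
  locp0 N m1 m2 m = (-1) ^+ xorsum N (fun i => pm m1 i && pm m2 i) * locp0 N m2 m1 m.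
Proof.
rewrite /locp0 /xorsum (big_morph (fun b : bool => (-1) ^+ b : K) (@signr_addb _) (erefl _)).
rewrite -big_split; apply: eq_bigr => i _ /=; rewrite /pm /loc0.
move: (bit m1 i) (bit m2 i) (bit m i) => [[] []] [[] []] [[] []] /=;
  by rewrite ?mulr0 ?mulr1 ?mul1r ?expr0 ?expr1 ?mulrNN ?mulr1.
Qed.

Lemma mulS_supercomm p q f g : homog p f -> homog q g ->
  mulS f g = scaleS ((-1) ^+ (p && q)) (mulS g f).
Proof.
move=> hf hg; apply/funext => m; rewrite /scaleS.
have b : belowm (Nof m) m by rewrite belowmE.
rewrite !(mulSE _ _ b) exchange_big mulr_sumr /=.
apply: eq_big_seq => m2; rewrite mem_mons => b2; rewrite mulr_sumr.
apply: eq_big_seq => m1; rewrite mem_mons => b1.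
have [->|nf] := eqVneq (f m1) 0; first by rewrite mul0r !mulr0.
have [->|ng] := eqVneq (g m2) 0; first by rewrite mul0r !mulr0.
rewrite locp0_swap -(hf _ nf) -(hg _ ng) (parityE b1) (parityE b2) [f m1 * _]mulrC !mulrA.
rewrite -!signr_addb; congr ((-1) ^+ _ * _ * _ * _).
rewrite /cliff_sgn; have := koszul_swap (Nof m) (pm m1) (pm m2).
move: (koszul _ (pm m1) (pm m2)) (koszul _ (pm m2) (pm m1)) (koszul _ (xb m1) (yb m1)) (koszul _ (xb m2) (yb m2))
  (koszul _ (xb m) (yb m)) (xorsum _ (pm m1)) (xorsum _ (pm m2)) (xorsum _ (fun i => pm m1 i && pm m2 i)).
by do 8 case.
Qed.

Definition locp1 k N m1 m2 m : K := \prod_(0 <= i < N)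
  (if i == k then loc1 K (bit m1 i) (bit m2 i) (bit m i) else loc0 K (bit m1 i) (bit m2 i) (bit m i)).

Lemma locp_coef1 N m1 m2 m : (locp K N m1 m2 m)`_1 = \sum_(0 <= k < N) locp1 k N m1 m2 m.
Proof.
rewrite /locp1; elim: N => [|N IH]; first by rewrite /locp !big_geq // coefC.
rewrite {1}/locp big_nat_recr //= -/(locp K N m1 m2 m) coefM big_ord_recl big_ord1 /= subn0 subnn.
rewrite loc_coef1 loc_coef0 big_nat_recr //= IH addrC mulr_suml; congr (_ + _).
  rewrite big_nat_recr //= eqxx locp_coef0; congr (_ * _).
  by apply: eq_big_nat => i /andP[_ iN]; rewrite ltn_eqF.
by apply: eq_big_nat => k /andP[_ kN]; rewrite big_nat_recr //= gtn_eqF.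
Qed.

Definition upy i (m : mon) : mon := (m.1, i |` m.2)%fset.
Definition upx i (m : mon) : mon := (i |` m.1, m.2)%fset.

Lemma belowm_upy i N m : (i < N)%N -> belowm N m -> belowm N (upy i m).
Proof.
move=> iN /andP[b1 /belowP b2]; rewrite /belowm b1; apply/belowP => j; rewrite !inE.
by case/predU1P => [->|/b2].
Qed.
Lemma belowm_upx i N m : (i < N)%N -> belowm N m -> belowm N (upx i m).
Proof.
move=> iN /andP[/belowP b1 b2]; rewrite /belowm b2 andbT; apply/belowP => j; rewrite !inE.
by case/predU1P => [->|/b1].
Qed.

Lemma sum_upy (R : nmodType) N i (phi : mon -> R) : (i < N)%N ->
  \sum_(m <- mons N | i \in m.2) phi m = \sum_(m <- mons N | i \notin m.2) phi (upy i m).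
Proof.
move=> iN; rewrite -[LHS]big_filter -[RHS]big_filter -[RHS](big_map (upy i) xpredT).
apply: perm_big; apply: uniq_perm; rewrite ?filter_uniq ?uniq_mons //.
  rewrite map_inj_in_uniq ?filter_uniq ?uniq_mons // => m m'.
  rewrite !mem_filter => /andP[n1 _] /andP[n2 _] [e1 e2].
  by rewrite [m]surjective_pairing [m']surjective_pairing -(fsetU1K n1) -(fsetU1K n2) e1 e2.
move=> m; rewrite mem_filter mem_mons; apply/andP/mapP => [[im b]|[m']].
  exists (m.1, m.2 `\ i)%fset; last by rewrite /upy /= fsetD1K //; case: (m).
  rewrite mem_filter mem_mons /= !inE eqxx /=.
  case/andP: b => b1 /belowP b2; rewrite /belowm b1; apply/belowP => j.
  by rewrite !inE => /andP[_ /b2].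
by rewrite mem_filter mem_mons => /andP[_ b ->]; rewrite belowm_upy //= !inE eqxx.
Qed.

Lemma sum_upx (R : nmodType) N i (phi : mon -> R) : (i < N)%N ->
  \sum_(m <- mons N | i \in m.1) phi m = \sum_(m <- mons N | i \notin m.1) phi (upx i m).
Proof.
move=> iN; rewrite -[LHS]big_filter -[RHS]big_filter -[RHS](big_map (upx i) xpredT).
apply: perm_big; apply: uniq_perm; rewrite ?filter_uniq ?uniq_mons //.
  rewrite map_inj_in_uniq ?filter_uniq ?uniq_mons // => m m'.
  rewrite !mem_filter => /andP[n1 _] /andP[n2 _] [e1 e2].
  by rewrite [m]surjective_pairing [m']surjective_pairing -(fsetU1K n1) -(fsetU1K n2) e1 e2.
move=> m; rewrite mem_filter mem_mons; apply/andP/mapP => [[im b]|[m']].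
  exists (m.1 `\ i, m.2)%fset; last by rewrite /upx /= fsetD1K //; case: (m).
  rewrite mem_filter mem_mons /= !inE eqxx /=.
  case/andP: b => /belowP b1 b2; rewrite /belowm b2 andbT; apply/belowP => j.
  by rewrite !inE => /andP[_ /b1].
by rewrite mem_filter mem_mons => /andP[_ b ->]; rewrite belowm_upx //= !inE eqxx.
Qed.

Lemma locp1_neq0 k N (m1 m2 m : mon) : (k < N)%N -> locp1 k N m1 m2 m != 0 -> (k \in m1.2) && (k \in m2.1).
Proof.
move=> kN; rewrite /locp1 (bigD1_seq k) ?mem_iota ?subn0 ?iota_uniq //= eqxx /loc1 mulf_eq0 negb_or.
by case/andP; rewrite /=; case: (k \in m1.2) (k \in m2.1) => [] [] //=; rewrite eqxx.
Qed.

Lemma locp1_up k N (m1 m2 m : mon) : (k < N)%N -> k \notin m1.2 -> k \notin m2.1 ->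
  locp1 k N (upy k m1) (upx k m2) m = locp0 N m1 m2 m.
Proof.
move=> kN n1 n2; apply: eq_bigr => i _; rewrite /bit /= !inE; case: eqP => [->|_] //=.
rewrite (negbTE n1) (negbTE n2) /loc1 /loc0 /= andbF orbF.
by rewrite /= expr0; case: (_ == _).
Qed.

(** The two counts are exactly the signs in [rdy k] and [ldx k]: y_k leaves the left factor through
    its right end, x_k leaves the right factor through its left end. *)
Lemma cliff_sgn_up k N (m1 m2 m : mon) : (k < N)%N -> k \notin m1.2 -> k \notin m2.1 ->
  belowm N m1 -> belowm N m2 ->
  cliff_sgn N (upy k m1) (upx k m2) m = cliff_sgn N m1 m2 m
    (+) odd (count (fun b => (k < b)%N) m1.2) (+) odd (count (fun a => (a < k)%N) m2.1).
Proof.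
move=> kN n1 n2 b1 b2.
rewrite (odd_count _ (proj2 (andP b1))) (odd_count _ (proj1 (andP b2))).
have ey : {in gtn N, yb (upy k m1) =1 fun i => yb m1 i (+) (i == k)}.
  by move=> i _; rewrite /yb /= !inE; case: eqP => [->|_]; rewrite ?(negbTE n1) //= addbF.
have ex : {in gtn N, xb (upx k m2) =1 fun i => xb m2 i (+) (i == k)}.
  by move=> i _; rewrite /xb /= !inE; case: eqP => [->|_]; rewrite ?(negbTE n2) //= addbF.
have ep1 : {in gtn N, pm (upy k m1) =1 fun i => pm m1 i (+) (i == k)}.
  by move=> i iN; rewrite /pm /pb /= -/(yb (upy k m1) i) ey // addbA.
have ep2 : {in gtn N, pm (upx k m2) =1 fun i => pm m2 i (+) (i == k)}.
  by move=> i iN; rewrite /pm /pb /= -/(xb (upx k m2) i) ex // addbAC.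
have er (P : nat -> bool) : {in gtn N, P =1 P} by [].
have E : koszul N (fun i => pm m1 i (+) (i == k)) (fun i => pm m2 i (+) (i == k))
    = koszul N (pm m1) (pm m2) (+) koszul N (pm m1) (eq_op^~ k)
      (+) (koszul N (eq_op^~ k) (pm m2) (+) koszul N (eq_op^~ k) (eq_op^~ k)).
  by rewrite (koszulDl N (pm m1)) (koszulDr N _ (pm m2)) (koszulDr N _ (pm m2)).
rewrite /cliff_sgn (eq_koszul ep1 ep2) (eq_koszul (er _) ey) (eq_koszul ex (er _)) E.
rewrite (koszulDr N _ (yb m1)) (koszulDl N (xb m2)).
rewrite -![yb (upx k m2)]/(yb m2) -![xb (upy k m1)]/(xb m1).
have -> : koszul N (pm m1) (eq_op^~ k) = koszul N (xb m1) (eq_op^~ k) (+) koszul N (yb m1) (eq_op^~ k).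
  by rewrite -koszulDl.
have -> : koszul N (eq_op^~ k) (pm m2) = koszul N (eq_op^~ k) (xb m2) (+) koszul N (eq_op^~ k) (yb m2).
  by rewrite -koszulDr.
have -> : koszul N (eq_op^~ k) (eq_op^~ k) = false.
  rewrite koszul_delta_l // /xorsum big1 // => i _; by case: ltngtP.
rewrite -(koszul_delta_r (yb m1) kN) -(koszul_delta_l (xb m2) kN).
move: (koszul N (pm m1) _) (koszul N (xb m1) (eq_op^~ k)) (koszul N (yb m1) (eq_op^~ k))
  (koszul N (eq_op^~ k) (xb m2)) (koszul N (eq_op^~ k) (yb m2)) (koszul N (xb m1) (yb m1)) (koszul N (xb m2) _) (koszul N (xb m) _).
by do 8 case.
Qed.

(** A term of order t contracts a single index k, with y_k in the left monomial and x_k in the right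
    one; deleting this pair reindexes the sum as a plain product of derivatives. *)
Lemma order1 N f g m : belowm N m -> (cliff_mul N (cpoly f) (cpoly g) m)`_1
  = \sum_(0 <= k < N) mulS (rdy k f) (ldx k g) m.
Proof.
move=> b; rewrite coef_cliff_mul.
under eq_bigr => m1 _ do under eq_bigr => m2 _ do rewrite locp_coef1 mulr_sumr mulr_suml.
under eq_bigr => m1 _ do rewrite exchange_big /=.
rewrite exchange_big /=; apply: eq_big_nat => k /andP[_ kN].
rewrite (mulSE _ _ b).
transitivity (\sum_(m1 <- mons N | k \in m1.2) \sum_(m2 <- mons N | k \in m2.1)
   (-1) ^+ cliff_sgn N m1 m2 m * locp1 k N m1 m2 m * (f m1 * g m2)).
  rewrite [RHS]big_mkcond; apply: eq_bigr => m1 _.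
  case: ifP => k1; last first.
    rewrite big1 // => m2 _; have [->|/(locp1_neq0 kN)] := eqVneq (locp1 k N m1 m2 m) 0.
      by rewrite mulr0 mul0r.
    by rewrite k1.
  rewrite [RHS]big_mkcond; apply: eq_bigr => m2 _; case: ifP => // k2.
  have [->|/(locp1_neq0 kN)] := eqVneq (locp1 k N m1 m2 m) 0; first by rewrite mulr0 mul0r.
  by rewrite k2 andbF.
rewrite (sum_upy _ kN) big_mkcond; apply: eq_big_seq => m1; rewrite mem_mons => b1.
case: ifP => n1; last first.
  by rewrite big1 // => m2 _; rewrite /rdy (negbFE n1) mul0r mulr0.
rewrite (sum_upx _ kN) big_mkcond; apply: eq_big_seq => m2; rewrite mem_mons => b2.
case: ifP => n2; last by rewrite /ldx (negbFE n2) !mulr0.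
rewrite locp1_up // cliff_sgn_up // /rdy /ldx (negbTE n1) (negbTE n2) -/(upy k m1) -/(upx k m2).
by rewrite !signr_addb !signr_odd; ring.
Qed.

End Order01.

(** * The first-order term and its relation to the Poisson bracket *)

Section FirstOrder.
Variable K : fieldType.
Implicit Types (f g h a b : ser K).

(** The operation |>, which is also the first half of the sum in [brS]. *)
Definition contr f g : ser K :=
  fun m => \sum_(i \in [set: nat]) mulS (rdy i f) (ldx i g) m.

Lemma mulSDl f f' g : mulS (addS f f') g = addS (mulS f g) (mulS f' g).
Proof. by rewrite -!(starc0 0) starcDl. Qed.
Lemma mulSDr f g g' : mulS f (addS g g') = addS (mulS f g) (mulS f g').
Proof. by rewrite -!(starc0 0) starcDr. Qed.
Lemma mulSZl k f g : mulS (scaleS k f) g = scaleS k (mulS f g).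
Proof. by rewrite -!(starc0 0) starcZl. Qed.
Lemma mulSZr k f g : mulS f (scaleS k g) = scaleS k (mulS f g).
Proof. by rewrite -!(starc0 0) starcZr. Qed.
Lemma mulS0l g : mulS (zeroS K) g = zeroS K.
Proof. by rewrite -(starc0 0) starc_zerol. Qed.
Lemma mulS0r f : mulS f (zeroS K) = zeroS K.
Proof. by rewrite -(starc0 0) starc_zeror. Qed.

Lemma mulS_coef0 N f g m : belowm N m -> (cliff_mul N (cpoly f) (cpoly g) m)`_0 = mulS f g m.
Proof.
move=> b; rewrite coef_cliff_mul (mulSE _ _ b).
by apply: eq_bigr => m1 _; apply: eq_bigr => m2 _; rewrite locp_coef0.
Qed.

(** No support condition is involved: at order t^0 only submonomials of [m] occur, so the finite
    algebra below [Nof m] decides. *)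
Lemma mulSA f g h : mulS (mulS f g) h = mulS f (mulS g h).
Proof.
apply/funext => m; have b : belowm (Nof m) m by rewrite belowmE.
rewrite -!(mulS_coef0 _ _ b).
rewrite (cliff_mul_trunc (n := 0) (F' := cliff_mul (Nof m) (cpoly f) (cpoly g)) (G' := cpoly h)) //; last first.
  by move=> m1 k b1; rewrite leqn0 => /eqP->; rewrite coefC (mulS_coef0 _ _ b1).
rewrite cliff_mul_assoc; symmetry; apply: (cliff_mul_trunc (n := 0)) => // m1 k b1.
by rewrite leqn0 => /eqP->; rewrite coefC (mulS_coef0 _ _ b1).
Qed.

Lemma mulS_neq0 f g m : mulS f g m != 0 -> exists A B,
  [/\ (A `<=` m.1)%fset, (B `<=` m.2)%fset, f (A, B) != 0
    & g (m.1 `\` A, m.2 `\` B)%fset != 0].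
Proof.
move=> /sum_neq0[A]; rewrite fpowersetE => sA /sum_neq0[B]; rewrite fpowersetE => sB nz.
exists A, B; split=> //; apply: contraNneq nz => ->; by rewrite ?mulr0 ?mul0r.
Qed.

Lemma below_sub N (A B : {fset nat}) : (A `<=` B)%fset -> below N B -> below N A.
Proof. by move=> /fsubsetP s /belowP h; apply/belowP => i /s /h. Qed.

Lemma belowm_split N (m : mon) (A B : {fset nat}) :
  (A `<=` m.1)%fset -> (B `<=` m.2)%fset -> belowm N m ->
  belowm N (A, B) && belowm N (m.1 `\` A, m.2 `\` B)%fset.
Proof.
move=> sA sB /andP[b1 b2]; rewrite /belowm /= (below_sub sA b1) (below_sub sB b2) /=.
by rewrite (below_sub (fsubsetDl _ _) b1) (below_sub (fsubsetDl _ _) b2).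
Qed.

Lemma eq_mulS N f f' g g' m : belowm N m ->
  (forall m1, belowm N m1 -> f m1 = f' m1) -> (forall m1, belowm N m1 -> g m1 = g' m1) ->
  mulS f g m = mulS f' g' m.
Proof.
move=> b ef eg; apply: eq_big_seq => A; rewrite fpowersetE => sA.
apply: eq_big_seq => B; rewrite fpowersetE => sB.
by have /andP[/ef -> /eg ->] := belowm_split sA sB b.
Qed.

(** A monomial of [g] containing x_i with i >= c must contain a y of larger index, which would
    remain in [m]. *)
Lemma mulS_ldx_big c N f g m i : xbound c g -> (c <= N)%N -> belowm N m -> (N <= i)%N ->
  mulS f (ldx i g) m = 0.
Proof.
move=> hg cN b Ni; apply/eqP/negPn/negP => /mulS_neq0[A [B [sA sB _]]].
rewrite /ldx; case: ifP => [_|_]; first by rewrite eqxx.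
rewrite mulf_eq0 negb_or => /andP[_ /hg] /=.
have /andP[_ /andP[_]] := belowm_split sA sB b; rewrite belowE /= => bB.
have ib : (i < barS (i |` (m.1 `\` A))%fset)%N by apply: ltn_barS; rewrite !inE eqxx.
move: ib bB cN Ni; set u := barS _; set v := barS _; lia.
Qed.

Lemma contr_sum c N f g m : xbound c g -> (c <= N)%N -> belowm N m ->
  contr f g m = \sum_(0 <= i < N) mulS (rdy i f) (ldx i g) m.
Proof.
move=> hg cN b; rewrite /contr (fsbigE (index_iota 0 N)) ?iota_uniq //.
- by apply: eq_bigl => i; rewrite in_setT.
- move=> i _; rewrite mem_iota subn0 add0n -leqNgt => Ni; exact: mulS_ldx_big hg cN b Ni.
Qed.

Lemma starc1 c f g : xbound c g -> starc c 1 f g = contr f g.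
Proof.
move=> hg; apply/funext => m; rewrite /starc order1 ?belowmE ?leq_maxr //.
by rewrite (contr_sum _ hg (leq_maxl c (Nof m))) // belowmE leq_maxr.
Qed.

Lemma xbound_mono c c' (f : ser K) : (c <= c')%N -> xbound c f -> xbound c' f.
Proof. by move=> le h m /h /orP[/leq_trans/(_ le) ->|->] //; rewrite orbT. Qed.
Lemma xbound_add c f g : xbound c f -> xbound c g -> xbound c (addS f g).
Proof.
move=> hf hg m; rewrite /addS.
by have [->|/hf //] := eqVneq (f m) 0; rewrite add0r => /hg.
Qed.
Lemma xbound_scale c k f : xbound c f -> xbound c (scaleS k f).
Proof. by move=> hf m; rewrite mulf_eq0 negb_or => /andP[_ /hf]. Qed.
Lemma xbound_mul c f g : xbound c f -> xbound c g -> xbound c (mulS f g).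
Proof. by rewrite -(starc0 c); apply: starc_xbound. Qed.
Lemma xbound_contr c f g : xbound c f -> xbound c g -> xbound c (contr f g).
Proof. by move=> hf hg; rewrite -(starc1 f hg); apply: starc_xbound. Qed.

Lemma contrDl c f f' g : xbound c g -> contr (addS f f') g = addS (contr f g) (contr f' g).
Proof. by move=> hg; rewrite -!(starc1 _ hg) starcDl. Qed.
Lemma contrZl c k f g : xbound c g -> contr (scaleS k f) g = scaleS k (contr f g).
Proof. by move=> hg; rewrite -!(starc1 _ hg) starcZl. Qed.
Lemma contrDr c f g g' : xbound c g -> xbound c g' -> contr f (addS g g') = addS (contr f g) (contr f g').
Proof.
by move=> hg hg'; rewrite -(starc1 _ hg) -(starc1 _ hg') -(starc1 _ (xbound_add hg hg')) starcDr.
Qed.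
Lemma contrZr c k f g : xbound c g -> contr f (scaleS k g) = scaleS k (contr f g).
Proof. by move=> hg; rewrite -(starc1 _ hg) -(starc1 _ (xbound_scale hg)) starcZr. Qed.
Lemma contr0r f : contr f (zeroS K) = zeroS K.
Proof. by rewrite -(starc1 (c := 0)) ?starc_zeror //; exact: xbound0. Qed.

(** The order t^1 of associativity, that is, the Hochschild cocycle identity for |>. *)
Lemma contr_assoc c f g h : xbound c f -> xbound c g -> xbound c h ->
  addS (contr f (mulS g h)) (mulS f (contr g h)) = addS (mulS (contr f g) h) (contr (mulS f g) h).
Proof.
move=> hf hg hh; apply/funext => m; have := starc_assoc 1 m hf hg hh.
rewrite !big_ord_recr !big_ord0 /= !add0r subnn subn0 !starc0 (starc1 _ hh) (starc1 _ hg).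
by rewrite (starc1 _ hh) (starc1 _ (xbound_mul hg hh)) /addS => e; rewrite -e addrC.
Qed.

Definition ydeg (d : nat) f := forall m, f m != 0 -> (#|` m.2| <= d)%N.

(** The order t^2 of associativity. The defect of a |> (b |> g) from (a |> b) |> g depends only on
    the product of a and b, which makes |> a left pre-Lie operation. *)
Lemma contr_comp c a b g : xbound c a -> xbound c b -> xbound c g -> ydeg 1 a -> ydeg 1 b ->
  contr a (contr b g) = addS (contr (contr a b) g) (starc c 2 (mulS a b) g).
Proof.
move=> ha hb hg ya yb; apply/funext => m; have := starc_assoc 2 m ha hb hg.
rewrite !big_ord_recr !big_ord0 /= !add0r subnn !subn0 !starc0 (_ : (2 - 1 = 1)%N) //.
(* A left factor of degree at most 1 in y admits no double contraction, so B_2(b, g), B_2(a, b) and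
   B_2(a, b g) vanish; only B_2(a b, g) survives. *)
rewrite (starc_big c g yb (r := 2)) // (starc_big c b ya (r := 2)) //.
rewrite (starc_big c (mulS b g) ya (r := 2)) // mulS0l mulS0r /zeroS !addr0 add0r.
by rewrite (starc1 _ hb) !(starc1 _ hg) (starc1 _ (xbound_contr hb hg)) /addS => <-; rewrite addrC.
Qed.

(** Parity components carry the sign rules, stated for homogeneous series, over to arbitrary
    ones. *)
Definition part (p : bool) f : ser K := fun m => if parity m == p then f m else 0.

Lemma part_split f : f = addS (part false f) (part true f).
Proof. by apply/funext => m; rewrite /addS /part; case: (parity m); rewrite /= ?addr0 ?add0r. Qed.
Lemma part_homog p f : homog p (part p f).
Proof. by move=> m; rewrite /part; case: (parity m =P p) => // _; rewrite eqxx. Qed.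
Lemma xbound_part c p f : xbound c f -> xbound c (part p f).
Proof. by move=> h m; rewrite /part; case: ifP => _; [exact: h|rewrite eqxx]. Qed.

Lemma starc_homog c r p q f g : homog p f -> homog q g -> homog (p (+) q) (starc c r f g).
Proof.
move=> hf hg m nz; set N := maxn c (Nof m).
have : cliff_mul N (cpoly f) (cpoly g) m != 0 by apply: contraNneq nz => e; rewrite /starc -/N e coef0.
move=> /cliff_mul_neq0[m1 [m2 [b1 b2 nl]]]; rewrite !polyC_eq0 => /hf <- /hg <-.
have b : belowm N m by rewrite belowmE leq_maxr.
rewrite (parityE b1) (parityE b2) (parityE b) -xorsumD; apply: eq_xorsum => i.
exact: locp_pm nl i.
Qed.

Lemma mulS_homog p q f g : homog p f -> homog q g -> homog (p (+) q) (mulS f g).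
Proof. by rewrite -(starc0 0); apply: starc_homog. Qed.
Lemma contr_homog c p q f g : xbound c g -> homog p f -> homog q g -> homog (p (+) q) (contr f g).
Proof. by move=> h; rewrite -(starc1 _ h); apply: starc_homog. Qed.
Lemma homog_scale p k f : homog p f -> homog p (scaleS k f).
Proof. by move=> h m; rewrite mulf_eq0 negb_or => /andP[_ /h]. Qed.

Lemma count_ltgt (i : nat) (A : {fset nat}) : i \notin A ->
  (count (fun j : nat => (j < i)%N) A + count (fun j : nat => (i < j)%N) A)%N = #|` A|.
Proof.
move=> iA; rewrite -(count_predC (fun j : nat => (j < i)%N)); congr (_ + _)%N.
apply: eq_in_count => j aA /=; case: (ltngtP j i) => // e.
by rewrite -e aA in iA.
Qed.

(** The letters that x_i crosses on its way out to the left and to the right are together all the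
    other letters of the monomial, in number of parity [~~ p]. *)
Lemma rdx_ldx i p f : homog p f -> rdx i f = scaleS ((-1) ^+ ~~ p) (ldx i f).
Proof.
move=> hf; apply/funext => m; rewrite /scaleS /rdx /ldx; case: ifP => [_|/negbT iA].
  by rewrite mulr0.
have [->|/hf] := eqVneq (f (i |` m.1, m.2)%fset) 0; first by rewrite !mulr0.
rewrite /parity /= cardfsU1 iA -(count_ltgt iA) mulrA -exprD => <-.
congr (_ * _); rewrite -signr_odd -[RHS]signr_odd; congr (_ ^+ _).
rewrite !oddD /= !oddb.
by move: (odd (count _ _)) (odd (count _ _)) (odd _) => [] [] [].
Qed.

Lemma ldy_rdy i p f : homog p f -> ldy i f = scaleS ((-1) ^+ ~~ p) (rdy i f).
Proof.
move=> hf; apply/funext => m; rewrite /scaleS /rdy /ldy; case: ifP => [_|/negbT iA].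
  by rewrite mulr0.
have [->|/hf] := eqVneq (f (m.1, i |` m.2)%fset) 0; first by rewrite !mulr0.
rewrite /parity /= cardfsU1 iA -(count_ltgt iA) mulrA -exprD => <-.
congr (_ * _); rewrite -signr_odd -[RHS]signr_odd; congr (_ ^+ _).
rewrite !oddD /= !oddb.
by move: (odd (count _ _)) (odd (count _ _)) (odd _) => [] [] [].
Qed.

Lemma ldx_homog i p f : homog p f -> homog (~~ p) (ldx i f).
Proof.
move=> hf m; rewrite /ldx; case: ifP => [_|/negbT iA]; first by rewrite eqxx.
rewrite mulf_eq0 negb_or => /andP[_ /hf] <-.
by rewrite /parity /= cardfsU1 iA /= negbK.
Qed.
Lemma rdy_homog i p f : homog p f -> homog (~~ p) (rdy i f).
Proof.
move=> hf m; rewrite /rdy; case: ifP => [_|/negbT iA]; first by rewrite eqxx.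
rewrite mulf_eq0 negb_or => /andP[_ /hf] <-.
by rewrite /parity /= cardfsU1 iA /= addnS /= negbK.
Qed.

(** Supercommuting the two derivatives in the second half of the bracket turns it into |> with the
    arguments exchanged. Thus the bracket is the supercommutator of the first-order term. *)
Lemma brS_contr c p q f g : xbound c f -> xbound c g -> homog p f -> homog q g ->
  brS f g = addS (contr f g) (scaleS (- (-1) ^+ (p && q)) (contr g f)).
Proof.
move=> Hf Hg hf hg; apply/funext => m.
pose N := maxn c (Nof m); have cN : (c <= N)%N := leq_maxl _ _.
have b : belowm N m by rewrite belowmE leq_maxr.
have E i : mulS (rdx i f) (ldy i g) m = - (-1) ^+ (p && q) * mulS (rdy i g) (ldx i f) m.
  rewrite (rdx_ldx i hf) (ldy_rdy i hg) mulSZl mulSZr.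
  rewrite (mulS_supercomm (ldx_homog (i := i) hf) (rdy_homog (i := i) hg)) /scaleS !mulrA.
  by congr (_ * _); case: p q {hf hg} => [] []; rewrite /= ?expr0 ?expr1; ring.
rewrite /addS /scaleS (contr_sum _ Hg cN b) (contr_sum _ Hf cN b) /brS.
rewrite (fsbigE (index_iota 0 N)) ?iota_uniq //.
  rewrite (eq_bigl xpredT); last by move=> i; rewrite in_setT.
  by rewrite big_split /=; congr (_ + _); rewrite mulr_sumr; apply: eq_bigr => i _; exact: E.
move=> i _; rewrite mem_iota subn0 add0n -leqNgt => Ni.
by rewrite E !(mulS_ldx_big _ _ cN b Ni) // mulr0 addr0.
Qed.

Definition yS i : ser K := fun m => if m == (fset0, [fset i]%fset) then 1 else 0.
Definition xS i : ser K := fun m => if m == ([fset i]%fset, fset0) then 1 else 0.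

Lemma mul1S f : mulS (oneS K) f = f.
Proof.
apply/funext => m; rewrite /mulS (bigD1_seq fset0) ?fset_uniq ?fpowersetE ?fsub0set //=.
rewrite (bigD1_seq fset0) ?fset_uniq ?fpowersetE ?fsub0set //=.
rewrite [X in _ + X + _]big1 ?addr0; last first.
  by move=> B nB; rewrite /oneS xpair_eqE (negbTE nB) andbF mulr0 mul0r.
rewrite big1 ?addr0; last first.
  by move=> A nA; rewrite big1 // => B _; rewrite /oneS xpair_eqE (negbTE nA) mulr0 mul0r.
by rewrite /oneS eqxx !fsetD0 /sgnM /ninv /= mul0n !big_seq_fset0 expr0 !mul1r; case: m.
Qed.

Lemma homog_one : homog false (oneS K).
Proof. by move=> m; rewrite /oneS; case: (m =P _) => [->|_]; rewrite ?eqxx // /parity !cardfs0. Qed.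

Lemma mulS1 f : mulS f (oneS K) = f.
Proof.
rewrite [f in LHS]part_split mulSDl.
rewrite !(mulS_supercomm (@part_homog _ _) homog_one) !andbF expr0 !mul1S.
by rewrite [f in RHS]part_split; apply/funext => m; rewrite /addS /scaleS !mul1r.
Qed.

End FirstOrder.

(** * The generators *)

Section Generators.
Variable K : fieldType.
Implicit Types (f g h a b : ser K).
Notation yS := (yS K).
Notation xS := (xS K).
Notation V := (V K).

Lemma rdy_yS j i : rdy j (yS i) = if j == i then oneS K else zeroS K.
Proof.
apply/funext => m; rewrite /rdy /yS xpair_eqE /=; case: ifP => jm.
  case: eqP => // _; rewrite /oneS; case: (m =P _) => // e; by rewrite e in jm.
case: (eqVneq j i) jm => [->|ne] jm; last first.
  case: ifP => [/andP[_ /eqP e]|]; last by rewrite mulr0.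
  by have := fset11 i; have := fset1U1 j m.2; rewrite e !inE (negbTE ne).
have -> : ((i |` m.2)%fset == [fset i]%fset) = (m.2 == fset0).
  apply/eqP/eqP => [e|->]; last by rewrite fsetU0.
  apply/fsetP => k; rewrite inE; apply/negbTE/negP => km.
  have : k \in (i |` m.2)%fset by rewrite !inE km orbT.
  by rewrite e inE => /eqP ki; rewrite ki jm in km.
have -> : oneS K m = if (m.1 == fset0) && (m.2 == fset0) then 1 else 0.
  by rewrite -xpair_eqE -surjective_pairing.
by case: ifP => [/andP[_ /eqP ->]|]; rewrite /= ?mulr0 ?expr0 ?mulr1.
Qed.

Lemma fset1U_neq0 (j : nat) (A : {fset nat}) : ((j |` A)%fset == fset0) = false.
Proof. by apply/negP => /eqP e; have := fset1U1 j A; rewrite e. Qed.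

Lemma ldx_yS j i : ldx j (yS i) = zeroS K.
Proof.
apply/funext => m; rewrite /ldx /yS xpair_eqE /= fset1U_neq0 /= mulr0.
by case: ifP.
Qed.

Lemma rdy_xS j i : rdy j (xS i) = zeroS K.
Proof.
apply/funext => m; rewrite /rdy /xS xpair_eqE /= fset1U_neq0 andbF /= mulr0.
by case: ifP.
Qed.

Lemma ldx_one j : ldx j (oneS K) = zeroS K.
Proof.
apply/funext => m; rewrite /ldx /oneS xpair_eqE /= fset1U_neq0 /= mulr0.
by case: ifP.
Qed.

Lemma ldx_xS j i : ldx j (xS i) = if j == i then oneS K else zeroS K.
Proof.
apply/funext => m; rewrite /ldx /xS xpair_eqE /=; case: ifP => jm.
  case: eqP => // _; rewrite /oneS; case: (m =P _) => // e; by rewrite e in jm.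
case: (eqVneq j i) jm => [->|ne] jm; last first.
  case: ifP => [/andP[/eqP e _]|]; last by rewrite mulr0.
  by have := fset11 i; have := fset1U1 j m.1; rewrite e !inE (negbTE ne).
have -> : ((i |` m.1)%fset == [fset i]%fset) = (m.1 == fset0).
  apply/eqP/eqP => [e|->]; last by rewrite fsetU0.
  apply/fsetP => k; rewrite inE; apply/negbTE/negP => km.
  have : k \in (i |` m.1)%fset by rewrite !inE km orbT.
  by rewrite e inE => /eqP ki; rewrite ki jm in km.
have -> : oneS K m = if (m.1 == fset0) && (m.2 == fset0) then 1 else 0.
  by rewrite -xpair_eqE -surjective_pairing.
by case: ifP => [/andP[/eqP -> _]|]; rewrite /= ?mulr0 ?expr0 ?mulr1.
Qed.

Lemma contr_y i g : contr (yS i) g = ldx i g.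
Proof.
apply/funext => m; rewrite /contr (fsbigE [:: i]) //.
  by rewrite big_seq_cond big_mkcond big_seq1 in_setT inE eqxx rdy_yS eqxx mul1S.
move=> j _; rewrite inE => ji; by rewrite rdy_yS (negbTE ji) mulS0l.
Qed.

Lemma contr_x i g : contr (xS i) g = zeroS K.
Proof. by apply/funext => m; rewrite /contr fsbig1 // => j _; rewrite rdy_xS mulS0l. Qed.
Lemma contr_oner f : contr f (oneS K) = zeroS K.
Proof. by apply/funext => m; rewrite /contr fsbig1 // => j _; rewrite ldx_one mulS0r. Qed.
Lemma contr_yr f i : contr f (yS i) = zeroS K.
Proof. by apply/funext => m; rewrite /contr fsbig1 // => j _; rewrite ldx_yS mulS0r. Qed.
Lemma contr_xr f i : contr f (xS i) = rdy i f.
Proof.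
apply/funext => m; rewrite /contr (fsbigE [:: i]) //.
  by rewrite big_seq_cond big_mkcond big_seq1 in_setT inE eqxx ldx_xS eqxx mulS1.
move=> j _; rewrite inE => ji; by rewrite ldx_xS (negbTE ji) mulS0r.
Qed.

Lemma barS0 : barS fset0 = 0%N.
Proof. by rewrite /barS big_seq_fset0. Qed.

Lemma xbound_y c i : xbound c (yS i).
Proof. by move=> m; rewrite /yS; case: (m =P _) => [->|_]; rewrite ?eqxx //= barS0. Qed.
Lemma xbound_x c i : (i < c)%N -> xbound c (xS i).
Proof.
move=> ic m; rewrite /xS; case: (m =P _) => [->|_]; rewrite ?eqxx //= -belowE => _.
by apply/orP; left; apply/belowP => j; rewrite inE => /eqP ->.
Qed.
Lemma xbound_one c : xbound c (oneS K).
Proof. by move=> m; rewrite /oneS; case: (m =P _) => [->|_]; rewrite ?eqxx //= barS0. Qed.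

Lemma homog_y i : homog true (yS i).
Proof.
by move=> m; rewrite /yS; case: (m =P _) => [->|_]; rewrite ?eqxx // /parity /= cardfs1.
Qed.
Lemma homog_x i : homog true (xS i).
Proof.
by move=> m; rewrite /xS; case: (m =P _) => [->|_]; rewrite ?eqxx // /parity /= cardfs1.
Qed.

(* The supercommutator with y_i is a derivation of the star product; at order t it is d/dx_i. *)
Lemma ldx_mul_homog i c p q b g : xbound c b -> xbound c g -> homog p b -> homog q g ->
  ldx i (mulS b g) = addS (mulS (ldx i b) g) (scaleS ((-1) ^+ p) (mulS b (ldx i g))).
Proof.
move=> Hb Hg hb hg; have Hy := @xbound_y c i; have hy := @homog_y i.
(* The cocycle identity with y_i in each of the three positions; y_i is then moved to the right, and
   every contraction into y_i vanishes. *)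
have e1 := contr_assoc Hy Hb Hg; have e3 := contr_assoc Hb Hy Hg; have e4 := contr_assoc Hb Hg Hy.
rewrite (mulS_supercomm hy hb) (contrZl _ _ Hg) in e1.
rewrite (mulS_supercomm hy (contr_homog Hg hb hg)) in e1.
rewrite (mulS_supercomm hy hg) (contrZr _ _ (xbound_mul Hg Hy)) in e3.
rewrite !contr_yr !contr_y in e1 e3 e4.
apply/funext => m; move/(congr1 (@^~ m)): e1; move/(congr1 (@^~ m)): e3.
move/(congr1 (@^~ m)): e4; rewrite /addS /scaleS mulS0l mulS0r /zeroS !addr0 add0r => ->.
set M := mulS (contr b g) (yS i) m; move=> e3 /(canRL (addrK _)) ->; rewrite -e3.
by case: p q {hb hg e3} => [] [] /=; ring.
Qed.

Lemma ldxD i f g : ldx i (addS f g) = addS (ldx i f) (ldx i g).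
Proof. by apply/funext => m; rewrite /ldx /addS; case: ifP => _; rewrite ?addr0 ?mulrDr. Qed.

Lemma ldx_mul i c p b g : xbound c b -> xbound c g -> homog p b ->
  ldx i (mulS b g) = addS (mulS (ldx i b) g) (scaleS ((-1) ^+ p) (mulS b (ldx i g))).
Proof.
move=> Hb Hg hb; rewrite [g]part_split !mulSDr !ldxD mulSDr.
rewrite !(ldx_mul_homog i Hb (xbound_part Hg) hb (@part_homog _ _ g)).
by apply/funext => m; rewrite /addS /scaleS; ring.
Qed.

Lemma mulS_suml N (u : nat -> ser K) h m :
  mulS (fun m => \sum_(0 <= i < N) u i m) h m = \sum_(0 <= i < N) mulS (u i) h m.
Proof.
elim: N => [|N IH].
  rewrite [RHS]big_geq // -[RHS]/(zeroS K m) -(mulS0l h); congr (mulS _ _ m).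
  by apply/funext => m'; rewrite big_geq.
rewrite big_nat_recr //= -IH -[RHS]/(addS _ _ m) -mulSDl; congr (mulS _ _ m).
by apply/funext => m'; rewrite big_nat_recr.
Qed.

Lemma mulS_sumr N (u : nat -> ser K) h m :
  mulS h (fun m => \sum_(0 <= i < N) u i m) m = \sum_(0 <= i < N) mulS h (u i) m.
Proof.
elim: N => [|N IH].
  rewrite [RHS]big_geq // -[RHS]/(zeroS K m) -(mulS0r h); congr (mulS _ _ m).
  by apply/funext => m'; rewrite big_geq.
rewrite big_nat_recr //= -IH -[RHS]/(addS _ _ m) -mulSDr; congr (mulS _ _ m).
by apply/funext => m'; rewrite big_nat_recr.
Qed.

(** Termwise, the Leibniz sign (-1)^q of d/dx_i and the sign of moving the y-derivative of [a], of
    parity [~~ p], past [g] combine to the sign for [a] itself. *)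
Lemma contr_deriv c p q a g h : xbound c g -> xbound c h -> homog p a -> homog q g ->
  contr a (mulS g h) = addS (mulS (contr a g) h) (scaleS ((-1) ^+ (p && q)) (mulS g (contr a h))).
Proof.
move=> Hg Hh ha hg; apply/funext => m.
pose N := maxn c (Nof m); have cN : (c <= N)%N := leq_maxl _ _.
have b : belowm N m by rewrite belowmE leq_maxr.
rewrite (contr_sum _ (xbound_mul Hg Hh) cN b) /addS /scaleS.
rewrite (eq_mulS b (fun m' w => contr_sum a Hg cN w) (fun _ _ => erefl)).
rewrite (eq_mulS b (fun _ _ => erefl) (fun m' w => contr_sum a Hh cN w)).
rewrite mulS_suml mulS_sumr mulr_sumr -big_split; apply: eq_bigr => i _ /=.
rewrite (ldx_mul i Hg Hh hg) mulSDr mulSZr -!mulSA.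
rewrite (mulS_supercomm (rdy_homog (i := i) ha) hg) mulSZl /addS /scaleS.
by case: p q {ha hg} => [] [] /=; ring.
Qed.

(** The cocycle identity at (x_j, a, g): a letter x of the left factor is never contracted. *)
Lemma contr_mulx c j a g : xbound c a -> xbound c g -> contr (mulS (xS j) a) g = mulS (xS j) (contr a g).
Proof.
move=> Ha Hg; pose d := maxn c j.+1.
have cd : (c <= d)%N := leq_maxl _ _; have jd : (j < d)%N := leq_maxr _ _.
have := contr_assoc (xbound_x jd) (xbound_mono cd Ha) (xbound_mono cd Hg); rewrite !contr_x mulS0l => e.
apply/funext => m; move/(congr1 (@^~ m)): e; by rewrite /addS /zeroS !add0r => ->.
Qed.

Lemma xS_neq0 i m : xS i m != 0 -> m = ([fset i]%fset, fset0).
Proof. by rewrite /xS; case: (m =P _) => // _; rewrite eqxx. Qed.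

Lemma mulxx i f : mulS (xS i) (mulS (xS i) f) = zeroS K.
Proof.
rewrite -mulSA; have -> : mulS (xS i) (xS i) = zeroS K; last by rewrite mulS0l.
apply/funext => m; apply/eqP/negPn/negP => /mulS_neq0[A [B [_ _ /xS_neq0[-> _] /xS_neq0[e _]]]].
by have := fset11 i; rewrite -e !inE eqxx.
Qed.

Lemma mulxC i j f : mulS (xS i) (mulS (xS j) f) = scaleS (-1) (mulS (xS j) (mulS (xS i) f)).
Proof. by rewrite -!mulSA (mulS_supercomm (@homog_x i) (@homog_x j)) mulSZl expr1. Qed.

Lemma mulxE i g m : mulS (xS i) g m =
  if i \in m.1 then (-1) ^+ ninv [fset i]%fset (m.1 `\ i)%fset * g (m.1 `\ i, m.2)%fset else 0.
Proof.
case: ifP => im; last first.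
  apply/eqP/negPn/negP => /mulS_neq0[A [B [sA _ /xS_neq0[e _] _]]].
  by have := fsubsetP sA i; rewrite e !inE eqxx im => /(_ isT).
rewrite /mulS (bigD1_seq [fset i]%fset) ?fset_uniq ?fpowersetE ?fsub1set //=.
rewrite (bigD1_seq fset0) ?fset_uniq ?fpowersetE ?fsub0set //=.
rewrite [X in _ + X + _]big1 ?addr0; last first.
  by move=> B nB; rewrite /xS xpair_eqE (negbTE nB) andbF mulr0 mul0r.
rewrite big1 ?addr0; last first.
  by move=> A nA; rewrite big1 // => B _; rewrite /xS xpair_eqE (negbTE nA) mulr0 mul0r.
rewrite /xS eqxx fsetD0 mulr1 /sgnM /= mul0n add0n.
by rewrite {2}/ninv big_seq_fset0 addn0.
Qed.

Lemma mem_Vmon1 i k x : (x \in (Vmon i k).1) <->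
  exists2 n, (n < k)%N & x = (i + 3 * n)%N \/ x = (i + 3 * n + 1)%N.
Proof.
rewrite (seq_fsetE tt) mem_cat; split=> [/orP[]/mapP[n]|[n nk [->|->]]].
- by rewrite mem_iota add0n => nk ->; exists n => //; left.
- by rewrite mem_iota add0n => nk ->; exists n => //; right.
- by apply/orP; left; apply/mapP; exists n; rewrite // mem_iota.
- by apply/orP; right; apply/mapP; exists n; rewrite // mem_iota.
Qed.

Lemma Vmon2 i k : (Vmon i k).2 = [fset (i + 3 * k)%N]%fset.
Proof. by apply/fsetP => x; rewrite (seq_fsetE tt) !inE. Qed.

Lemma Vmon0 i : Vmon i 0 = (fset0, [fset i]%fset).
Proof.
rewrite [LHS]surjective_pairing Vmon2 muln0 addn0; congr (_, _); apply/fsetP => x.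
rewrite inE; apply/negbTE/negP; by move=> /mem_Vmon1[].
Qed.

Lemma VmonS i k : Vmon i k.+1 = ((i |` (i.+1 |` (Vmon (i + 3) k).1))%fset, (Vmon (i + 3) k).2).
Proof.
rewrite [LHS]surjective_pairing !Vmon2; congr (_, [fset _]%fset); last by lia.
apply/fsetP => x; apply/idP/idP.
  move=> /mem_Vmon1[[|n] nk e]; first by rewrite !inE; case: e => ->; apply/orP; [left|right]; apply/orP || apply/eqP; lia.
  rewrite in_fset1U in_fset1U; apply/orP; right; apply/orP; right; apply/mem_Vmon1.
  by exists n => //; case: e => ->; [left|right]; lia.
rewrite in_fset1U in_fset1U => /orP[/eqP ->|/orP[/eqP ->|/mem_Vmon1[n nk e]]]; apply/mem_Vmon1.
- by exists 0%N => //; left; lia.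
- by exists 0%N => //; right; lia.
- by exists n.+1 => //; case: e => ->; [left|right]; lia.
Qed.

Lemma V_neq0 i m : V i m != 0 -> exists k, m = Vmon i k.
Proof. by rewrite /V; case: asboolP => // _; rewrite eqxx. Qed.

Lemma xbound_V c i : xbound c (V i).
Proof.
move=> m /V_neq0[k ->]; apply/orP; right; apply: (@leq_ltn_trans (i + 3 * k)%N); last first.
  by apply: ltn_barS; rewrite Vmon2 inE.
rewrite -belowE; apply/belowP => x /mem_Vmon1[n nk [->|->]]; lia.
Qed.

Lemma Vmon1_ge i k x : x \in (Vmon i k).1 -> (i <= x)%N.
Proof. by move=> /mem_Vmon1[n _ [->|->]]; lia. Qed.

Lemma parity_Vmon i k : parity (Vmon i k) = true.
Proof.
elim: k i => [|k IH] i; first by rewrite Vmon0 /parity /= cardfs1.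
have h := IH (i + 3)%N; rewrite VmonS.
have n1 : (i.+1 \in (Vmon (i + 3) k).1) = false by apply/negP => /Vmon1_ge; lia.
have n2 : (i \in (Vmon (i + 3) k).1) = false by apply/negP => /Vmon1_ge; lia.
have n3 : (i == i.+1) = false by apply/eqP; lia.
by move: h; rewrite /parity !cardfsU1 !in_fset1U n1 n2 n3 /= negbK.
Qed.

Lemma homog_V i : homog true (V i).
Proof. by move=> m /V_neq0[k ->]; exact: parity_Vmon. Qed.

Lemma ldx_V j i : (j < i)%N -> ldx j (V i) = zeroS K.
Proof.
move=> ji; apply/funext => m; rewrite /ldx; case: ifP => // _.
have [->|/V_neq0[k [e _]]] := eqVneq (V i (j |` m.1, m.2)%fset) 0; first by rewrite mulr0.
by have := fset1U1 j m.1; rewrite e => /(Vmon1_ge (k := k)); rewrite leqNgt ji.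
Qed.

Lemma rdy_V j i : (j < i)%N -> rdy j (V i) = zeroS K.
Proof.
move=> ji; apply/funext => m; rewrite /rdy; case: ifP => // _.
have [->|/V_neq0[k e]] := eqVneq (V i (m.1, j |` m.2)%fset) 0; first by rewrite mulr0.
have := fset1U1 j m.2; rewrite -[(j |` m.2)%fset]/((m.1, j |` m.2)%fset.2) e Vmon2 inE => /eqP; lia.
Qed.

Lemma V_Vmon i k : V i (Vmon i k) = 1.
Proof. by rewrite /V; case: asboolP => // -[]; exists k. Qed.

Lemma ninv_lt i (A : {fset nat}) : (forall j, j \in A -> (i < j)%N) -> ninv [fset i]%fset A = 0%N.
Proof.
move=> h; rewrite /ninv big_seq_fset1 big_seq big1 // => j /h.
by case: (ltngtP j i).
Qed.

(** The letters x_i and x_(i+1) precede all letters x of V_(i+3), so no sign appears. *)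
Lemma V_rec i : V i = addS (yS i) (mulS (xS i) (mulS (xS i.+1) (V (i + 3)))).
Proof.
apply/funext => m; rewrite /addS.
have [[k ->]|nex] := pselect (exists k, m = Vmon i k).
  rewrite V_Vmon; case: k => [|k].
    by rewrite Vmon0 /yS eqxx mulxE /= addr0.
  rewrite VmonS /yS xpair_eqE fset1U_neq0 /= add0r mulxE /= fset1U1.
  have h j : j \in (Vmon (i + 3) k).1 -> (i.+1 < j)%N by move=> /Vmon1_ge; lia.
  have nS : i.+1 \notin (Vmon (i + 3) k).1 by apply/negP => /h; rewrite ltnn.
  have ni : i \notin (i.+1 |` (Vmon (i + 3) k).1)%fset.
    rewrite !inE negb_or; apply/andP; split; first by rewrite neq_ltn ltnSn.
    by apply/negP => /h; lia.
  rewrite fsetU1K // mulxE fset1U1 fsetU1K // -[X in V _ X]/(Vmon (i + 3) k) V_Vmon.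
  rewrite !ninv_lt ?expr0 ?mulr1 //.
  by move=> j; rewrite in_fset1U => /predU1P[->//|/h]; lia.
have -> : V i m = 0 by apply/eqP/negPn/negP => /V_neq0.
have -> : yS i m = 0.
  by rewrite /yS; case: (m =P _) => // e; case: nex; exists 0%N; rewrite Vmon0.
rewrite add0r mulxE; case: ifP => // im; rewrite mulxE /=; case: ifP => [iSm|]; last by rewrite mulr0.
have [->|/V_neq0[k e]] := eqVneq (V (i + 3) (((m.1 `\ i) `\ i.+1)%fset, m.2)) 0.
  by rewrite !mulr0.
case: nex; exists k.+1; rewrite VmonS -e /= fsetD1K // fsetD1K //; by case: (m).
Qed.

End Generators.

(** * The pre-Lie product on x_s V_n *)

Section PreLie.
Variable K : fieldType.
Implicit Types (f g h : ser K).
Notation V := (V K).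
Local Notation zero := (zeroS K).

Lemma scaleS0 f : scaleS 0 f = zero.
Proof. by apply/funext => m; rewrite /scaleS mul0r. Qed.
Lemma scaleSr0 k : scaleS k zero = zero.
Proof. by apply/funext => m; rewrite /scaleS mulr0. Qed.
Lemma scaleS1 f : scaleS 1 f = f.
Proof. by apply/funext => m; rewrite /scaleS mul1r. Qed.
Lemma scaleSS k l f : scaleS k (scaleS l f) = scaleS (k * l) f.
Proof. by apply/funext => m; rewrite /scaleS mulrA. Qed.
Lemma add0S f : addS zero f = f.
Proof. by apply/funext => m; rewrite /addS add0r. Qed.
Lemma addS0 f : addS f zero = f.
Proof. by apply/funext => m; rewrite /addS addr0. Qed.

(** The bound stays existential, since multiplying by x_i may raise it. *)
Definition xbounded f := exists c, xbound c f.
Definition xm i f := mulS (xS K i) f.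
Definition Vder i f := contr (V i) f.
Definition xmon (s : seq nat) n := foldr xm (V n) s.

Lemma xbounded_V i : xbounded (V i). Proof. by exists 0%N; apply: xbound_V. Qed.
Lemma xbounded_xm i f : xbounded f -> xbounded (xm i f).
Proof.
case=> c h; exists (maxn c i.+1); apply: xbound_mul; first by apply: xbound_x; rewrite leq_maxr.
by apply: xbound_mono h; rewrite leq_maxl.
Qed.
Lemma xbounded_foldr f s : xbounded f -> xbounded (foldr xm f s).
Proof. by move=> h; elim: s => //= i s; apply: xbounded_xm. Qed.
Lemma xbounded_xmon s n : xbounded (xmon s n).
Proof. by apply: xbounded_foldr; apply: xbounded_V. Qed.

Lemma xmC i j f : xm i (xm j f) = scaleS (-1) (xm j (xm i f)).
Proof. exact: mulxC. Qed.
Lemma xmZ i k f : xm i (scaleS k f) = scaleS k (xm i f).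
Proof. exact: mulSZr. Qed.
Lemma xm0 i : xm i zero = zero.
Proof. exact: mulS0r. Qed.
Lemma foldr_xmZ k f s : foldr xm (scaleS k f) s = scaleS k (foldr xm f s).
Proof. by elim: s => //= i s ->; rewrite xmZ. Qed.
Lemma foldr_xm0 s : foldr xm zero s = zero.
Proof. by elim: s => //= i s ->; rewrite xm0. Qed.

(** The sign does not depend on [f], so a letter can be pulled out of x_s V_n and of x_s (V_n |>
    V_i) alike. *)
Lemma foldr_pull i s : i \in s ->
  exists e : bool, forall f, foldr xm f s = scaleS ((-1) ^+ e) (xm i (foldr xm f (rem i s))).
Proof.
elim: s => //= j s IH; rewrite inE; have [->|ne] /= := eqVneq i j.
  by exists false => f; rewrite scaleS1.
move=> /IH[e h]; exists (~~ e) => f; rewrite /= h xmZ xmC scaleSS.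
by congr (scaleS _ _); case: e {h}; rewrite /=; ring.
Qed.

Lemma xm_in0 i f s : i \in s -> xm i (foldr xm f s) = zero.
Proof. by move=> /foldr_pull[e ->]; rewrite xmZ /xm mulxx scaleSr0. Qed.

Lemma foldr_xm_pair i j f s : foldr xm (xm i (xm j f)) s = xm i (xm j (foldr xm f s)).
Proof.
elim: s => //= k s ->; rewrite xmC [xm k (xm j _)]xmC xmZ scaleSS mulrNN mulr1.
by rewrite scaleS1.
Qed.

Lemma Vder_rec i f : xbounded f -> Vder i f = addS (ldx i f) (xm i (xm i.+1 (Vder i.+3 f))).
Proof.
case=> c h; rewrite /Vder [V i in LHS]V_rec (contrDl _ _ h) contr_y addn3; congr addS.
have H3 : xbound (maxn c i.+2) (V i.+3) by apply: xbound_V.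
have h' : xbound (maxn c i.+2) f by apply: xbound_mono h; rewrite leq_maxl.
rewrite (contr_mulx _ _ h') ?(contr_mulx _ _ h') //; apply: xbound_mul => //.
by apply: xbound_x; rewrite leq_maxr.
Qed.

Lemma Vder_xm i j f : xbounded f -> Vder i (xm j f) = addS (mulS (rdy j (V i)) f) (scaleS (-1) (xm j (Vder i f))).
Proof.
case=> c h; pose d := maxn c j.+1.
have h' : xbound d f by apply: xbound_mono h; rewrite leq_maxl.
have hx : xbound d (xS K j) by apply: xbound_x; rewrite leq_maxr.
by rewrite /Vder (contr_deriv hx h' (homog_V (i := i)) (homog_x (i := j))) contr_xr expr1.
Qed.

Lemma Vder_xm_lt i j f : (j < i)%N -> xbounded f -> Vder i (xm j f) = scaleS (-1) (xm j (Vder i f)).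
Proof. by move=> ji h; rewrite Vder_xm // rdy_V // mulS0l add0S. Qed.

Lemma ldx_xm i j f : xbounded f ->
  ldx i (xm j f) = addS (if i == j then f else zero) (scaleS (-1) (xm j (ldx i f))).
Proof.
case=> c h; pose d := maxn c j.+1.
have h' : xbound d f by apply: xbound_mono h; rewrite leq_maxl.
have hx : xbound d (xS K j) by apply: xbound_x; rewrite leq_maxr.
rewrite /xm (ldx_mul i hx h' (homog_x (i := j))) ldx_xS expr1; congr addS.
by case: eqP => _; rewrite ?mul1S ?mulS0l.
Qed.

Lemma ldx_xm_neq i j f : xbounded f -> i != j -> ldx i (xm j f) = scaleS (-1) (xm j (ldx i f)).
Proof. by move=> h ne; rewrite ldx_xm // (negbTE ne) add0S. Qed.

Lemma V_xm i : V i = addS (yS K i) (xm i (xm i.+1 (V i.+3))).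
Proof. by rewrite [LHS]V_rec addn3. Qed.

Lemma Vder_V_lt i j : (j.+2 <= i)%N -> Vder i (V j) = xm j (xm j.+1 (Vder i (V j.+3))).
Proof.
move=> ji; have H := xbounded_xm j (xbounded_xm j.+1 (xbounded_V j.+3)); case: (H) => c Hcc.
rewrite {1}V_xm /Vder (contrDr _ (@xbound_y K c j) Hcc) contr_yr add0S.
rewrite -/(Vder i _) Vder_xm_lt //; [|lia|by apply: xbounded_xm; apply: xbounded_V].
rewrite Vder_xm_lt //; last by apply: xbounded_V.
by rewrite xmZ scaleSS mulrNN mulr1 scaleS1.
Qed.

Lemma Vder_V_gt i n : (i < n)%N -> Vder i (V n) = xm i (xm i.+1 (Vder i.+3 (V n))).
Proof. by move=> lt; rewrite Vder_rec ?ldx_V ?add0S //; apply: xbounded_V. Qed.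

Lemma ldx_V_rec i k : ldx k (V i) = ldx k (xm i (xm i.+1 (V i.+3))).
Proof. by rewrite {1}V_xm ldxD ldx_yS add0S. Qed.

Lemma ldx_VV i : ldx i (V i) = xm i.+1 (V i.+3).
Proof.
rewrite ldx_V_rec ldx_xm ?eqxx; last by apply: xbounded_xm; apply: xbounded_V.
rewrite ldx_xm_neq; [|exact: xbounded_V|by rewrite neq_ltn ltnSn].
rewrite ldx_V; last by lia.
by rewrite xm0 scaleSr0 xm0 scaleSr0 addS0.
Qed.

(** This and the next lemmas tabulate V_i |> V_n for |i - n| <= 2. Unfolding [V_rec] on either side
    soon repeats some x_j, whose square is 0, and this removes the infinite tails. *)
Lemma Vder_VV i : Vder i (V i) = xm i.+1 (V i.+3).
Proof.
rewrite Vder_rec; last exact: xbounded_V.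
rewrite ldx_VV Vder_V_lt; last by lia.
rewrite (xm_in0 _ (s := [:: i.+1; i; i.+1])) ?addS0 //.
by rewrite !inE eqxx orbT.
Qed.

Lemma Vder_VS i : Vder i.+1 (V i) = scaleS (-1) (xm i (V i.+3)).
Proof.
rewrite Vder_rec; last exact: xbounded_V.
rewrite Vder_V_lt; last by lia.
rewrite [X in addS _ X](_ : _ = zero) ?addS0; last first.
  by rewrite (xm_in0 _ (s := [:: i.+2; i; i.+1])) // !inE eqxx !orbT.
rewrite ldx_V_rec ldx_xm_neq; [|by apply: xbounded_xm; apply: xbounded_V|by rewrite neq_ltn ltnSn orbT].
rewrite ldx_xm ?eqxx; last exact: xbounded_V.
by rewrite ldx_V ?xm0 ?scaleSr0 ?addS0 //; lia.
Qed.

Lemma Vder_V_succ i : Vder i (V i.+1) = zero.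
Proof.
rewrite Vder_V_gt // Vder_V_lt; last by lia.
rewrite (_ : xm i.+1 _ = zero) ?xm0 //.
by rewrite (xm_in0 _ (s := [:: i.+1; i.+2])) // inE eqxx.
Qed.

Lemma Vder_V_succ2 i : Vder i.+2 (V i) = zero.
Proof. by rewrite Vder_V_lt // Vder_V_succ !xm0. Qed.

Lemma Vder_V_pred2 i : Vder i (V i.+2) = scaleS (-1) (xmon [:: i; i.+1; i.+2] i.+2.+3).
Proof. by rewrite Vder_V_gt // Vder_VS !xmZ. Qed.

Lemma Vder_foldr_lt i f s : all (fun j => (j < i)%N) s -> xbounded f ->
  Vder i (foldr xm f s) = scaleS ((-1) ^+ size s) (foldr xm (Vder i f) s).
Proof.
move=> + h; elim: s => [|j s IH] /=; first by rewrite scaleS1.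
move=> /andP[ji /IH e]; rewrite Vder_xm_lt //; last exact: xbounded_foldr.
by rewrite e xmZ scaleSS exprS.
Qed.

Lemma ldx_foldr i f s : i \notin s -> xbounded f -> ldx i f = zero -> ldx i (foldr xm f s) = zero.
Proof.
move=> + h e; elim: s => //= j s IH; rewrite inE negb_or => /andP[ne /IH is0].
by rewrite ldx_xm_neq ?is0 ?xm0 ?scaleSr0 //; apply: xbounded_foldr.
Qed.

(** The gap of two is attained by V_i |> V_i = x_(i+1) V_(i+3), is preserved by brackets with V_0,
    V_1, V_2, and is the range in which [Vder_V_lt] applies. *)
Definition good (s : seq nat) n := all (fun j => (j.+2 <= n)%N) s.

(* The two terms V_i |> w and -+ w |> V_i of the bracket of V_i with w = x_s V_n are
   multiples of one monomial, and they can only cancel when V_i |> w is already 0. *)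
Definition halves i s n := exists c0 c1 s' n',
  [/\ good s' n', (n <= n')%N, Vder i (xmon s n) = scaleS c0 (xmon s' n'),
      scaleS ((-1) ^+ size s) (foldr xm (Vder n (V i)) s) = scaleS c1 (xmon s' n')
    & c0 + c1 = 0 -> c0 = 0].

(** In V_i |> w the derivative d/dx_i removes x_i, and the tail of V_i dies because it brings a
    second x_i. The other half dies for the same reason, V_n |> V_i being divisible by x_i. If x_i
    already occurs twice in w, everything is 0. *)
Lemma halves_in i s n : good s n -> i \in s -> halves i s n.
Proof.
move=> gs is_; have ni : (i.+2 <= n)%N by exact: (allP gs).
have [e pull] := foldr_pull is_.
have [ir|ir] := boolP (i \in rem i s).
  have z f : foldr xm f s = zero by rewrite pull xm_in0 // scaleSr0.
  exists 0, 0, s, n; split=> //; rewrite ?scaleS0 /xmon z ?scaleSr0 //.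
  by rewrite /Vder contr0r.
exists ((-1) ^+ e), 0, (rem i s), n; split=> //.
- by apply/allP => j /mem_rem; exact: (allP gs).
- rewrite /xmon pull -/(xmon _ _); have hw := xbounded_xmon (rem i s) n.
  rewrite {1}/Vder; case: (xbounded_xm i hw) => c Hcc; rewrite (contrZr _ _ Hcc) -/(Vder i _); congr scaleS.
  rewrite Vder_rec; last exact: xbounded_xm.
  rewrite ldx_xm // eqxx [ldx i _]ldx_foldr ?ldx_V //; [|exact: xbounded_V|by lia].
  rewrite Vder_xm_lt //; last by lia.
  rewrite !xmZ (xm_in0 _ (s := [:: i.+1; i])) ?inE ?eqxx ?orbT //.
  by rewrite xm0 !scaleSr0 !addS0.
- rewrite Vder_V_lt // foldr_xm_pair pull !xmZ.
  by rewrite (xm_in0 _ (s := [:: i.+1; i])) ?inE ?eqxx ?orbT // !scaleSr0 scaleS0.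
by rewrite addr0.
Qed.

Lemma good_lt i n s : good s n -> (n <= i.+1)%N -> all (fun j => (j < i)%N) s.
Proof. by move=> g ni; apply: sub_all g => j; lia. Qed.

Lemma good_le n n' s : good s n -> (n <= n')%N -> good s n'.
Proof. by move=> g ni; apply: sub_all g => j; lia. Qed.

Hypothesis char2 : (2%:R : K) != 0.

(** Induction on n - i in steps of 3: when x_i does not occur in w and n >= i + 3, both halves are
    x_i x_(i+1) times the corresponding halves for V_(i+3), with unchanged coefficients. The
    differences 0, 1, 2 come from the table. *)
Lemma halves_ge i n s : (i <= n)%N -> good s n -> halves i s n.
Proof.
move=> /subnKC <-; move: (n - i)%N => d {n}.
elim/ltn_ind: d i s => d IH i s gs.
have [is_|is_] := boolP (i \in s); first exact: halves_in.
case: d IH gs => [|[|[|d]]] IH gs.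
(* For n = i both halves equal (-1)^|s| x_s x_(i+1) V_(i+3), so their sum is nonzero because 2
   is. *)
- rewrite addn0 in gs *; have lt := good_lt gs (leqnSn i).
  exists ((-1) ^+ size s), ((-1) ^+ size s), (rcons s i.+1), i.+3; split.
  + by rewrite /good all_rcons leqnn; apply: good_le gs _; lia.
  + by lia.
  + by rewrite Vder_foldr_lt // ?Vder_VV -?cats1 /xmon ?foldr_cat //; apply: xbounded_V.
  + by rewrite Vder_VV -cats1 /xmon foldr_cat.
  rewrite -mulr2n -mulr_natr => /eqP; rewrite mulf_eq0 (negbTE char2) orbF => /eqP; exact.
- rewrite addn1 in gs *; have lt := good_lt gs (leqnn _).
  exists 0, (- (-1) ^+ size s), (rcons s i), i.+3; split=> //.
  + by rewrite /good all_rcons leqnSn; apply: good_le gs _; lia.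
  + by lia.
  + rewrite Vder_foldr_lt // ?Vder_V_succ ?foldr_xm0 ?scaleSr0 ?scaleS0 //; exact: xbounded_V.
  + by rewrite Vder_VS foldr_xmZ scaleSS mulrN1 -cats1 /xmon foldr_cat.
- rewrite addn2 in gs *.
  (* [good] only gives j <= i here; the value i is excluded by [is_]. *)
  have lt : all (fun j => (j < i)%N) s.
    apply/allP => j js; have := allP gs j js; rewrite !ltnS leq_eqVlt => /predU1P[e|//].
    by rewrite -e js in is_.
  exists (- (-1) ^+ size s), 0, (s ++ [:: i; i.+1; i.+2]), i.+2.+3; split=> //.
  + by rewrite /good all_cat; apply/andP; split; [apply: good_le gs _; lia|rewrite /=; lia].
  + by lia.
  + rewrite Vder_foldr_lt // ?Vder_V_pred2 ?foldr_xmZ ?scaleSS ?mulrN1 ?/xmon ?foldr_cat //.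
    exact: xbounded_V.
  + by rewrite Vder_V_succ2 foldr_xm0 scaleSr0 scaleS0.
  by rewrite addr0.
have en : (i + d.+3 = i.+3 + d)%N by lia.
rewrite en in gs *.
have [|c0 [c1 [s' [n' [g' le e0 e1 nz]]]]] := IH d _ i.+3 s gs; first by lia.
exists c0, c1, (i :: i.+1 :: s'), n'; split=> //.
(* The clause [n <= n'] in [halves] serves here: it leaves room for x_i and x_(i+1) before V_n'. *)
- by move: g'; rewrite /good /= => ->; rewrite andbT; apply/andP; split; lia.
- rewrite Vder_rec; last exact: xbounded_xmon.
  rewrite [ldx i _]ldx_foldr ?ldx_V ?add0S //; [|exact: xbounded_V|by lia].
  by rewrite e0 !xmZ.
rewrite Vder_V_lt; last by lia.
by rewrite foldr_xm_pair -!xmZ e1.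
Qed.

(** If n < i <= 2, then n <= 1 and [good] forces [s] to be empty; two entries of the table
    remain. *)
Lemma halves_all i n s : (i <= 2)%N -> good s n -> halves i s n.
Proof.
move=> i2 gs; have [/halves_ge|ni] := leqP i n; first exact.
case: s gs => [_|j s]; last by rewrite /good /=; lia.
have [->|->] : i = n.+1 \/ i = n.+2 by lia.
  exists (-1), 0, [:: n], n.+3; split=> //; rewrite /good /= ?leqnSn //; first by lia.
  - by rewrite /xmon /= Vder_VS.
  - by rewrite Vder_V_succ scaleSr0 scaleS0.
  by rewrite addr0.
exists 0, (-1), [:: n; n.+1; n.+2], n.+2.+3; split=> //.
- by rewrite /good /=; lia.
- by lia.
- by rewrite /xmon /= Vder_V_succ2 scaleS0.
- by rewrite /= Vder_V_pred2 scaleS1.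
Qed.

Lemma homog_xmon s n : homog (odd (size s).+1) (xmon s n).
Proof.
elim: s => [|i s IH]; first exact: homog_V.
exact: (mulS_homog (@homog_x K i) IH).
Qed.

Lemma contr_xmon s n i : contr (xmon s n) (V i) = foldr xm (Vder n (V i)) s.
Proof.
elim: s => //= j s <-; case: (xbounded_xmon s n) => c h.
exact: (contr_mulx _ h (@xbound_V K c i)).
Qed.

Lemma brS_V_xmon i s n : brS (V i) (xmon s n)
  = addS (Vder i (xmon s n)) (scaleS ((-1) ^+ size s) (foldr xm (Vder n (V i)) s)).
Proof.
case: (xbounded_xmon s n) => c h.
rewrite (brS_contr (@xbound_V K c i) h (homog_V (i := i)) (homog_xmon (s := s) (n := n))) contr_xmon.
by congr (addS _ (scaleS _ _)); rewrite /= -[RHS]signr_odd; case: (odd _); rewrite /=; ring.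
Qed.

Lemma V_xmon_bracket i s n : (i <= 2)%N -> good s n -> exists c c' s' n',
  [/\ good s' n', brS (V i) (xmon s n) = scaleS c (xmon s' n')
    & Vder i (xmon s n) = scaleS c' (brS (V i) (xmon s n))].
Proof.
move=> i2 /(halves_all i2)[c0 [c1 [s' [n' [g _ e0 e1 nz]]]]].
have e : brS (V i) (xmon s n) = scaleS (c0 + c1) (xmon s' n').
  by rewrite brS_V_xmon e0 e1; apply/funext => m; rewrite /addS /scaleS mulrDl.
exists (c0 + c1), (c0 / (c0 + c1)), s', n'; split=> //.
(* When c0 + c1 = 0, the last clause of [halves] gives c0 = 0, and both sides are 0. *)
rewrite e e0 scaleSS; have [z|ne] := eqVneq (c0 + c1) 0; last by rewrite divfK.
by rewrite z (nz z) !mul0r.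
Qed.

End PreLie.

(** * Closure of P[t] *)

Section PoissonHull.
Variable K : fieldType.
Hypothesis char2 : (2%:R : K) != 0.
Implicit Types (f g h a b w : ser K).
Notation V := (V K).

(** The letters of a good [s] are below n, so every monomial keeps its single y on top. Membership
    in H~ and degree 1 in y follow. *)
Lemma xmon_supp s n m : good s n -> xmon K s n m != 0 ->
  exists k, m.2 = [fset (n + 3 * k)%N]%fset /\ forall x, x \in m.1 -> (x < n + 3 * k)%N.
Proof.
elim: s m => [|i s IH] m.
  move=> _ /V_neq0[k ->]; exists k; split; first exact: Vmon2.
  by move=> x /mem_Vmon1[j jk [->|->]]; lia.
move=> /andP[i_n gs]; rewrite /xmon /= -/(xmon K s n) /xm mulxE; case: ifP => im.
  rewrite mulf_eq0 negb_or => /andP[_ /(IH _ gs)[k [e h]]]; exists k; split=> // x xm.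
  by have [->|ne] := eqVneq x i; [lia|apply: h; rewrite /= !inE ne].
by rewrite eqxx.
Qed.

Lemma xbound_xmon c s n : good s n -> xbound c (xmon K s n).
Proof.
move=> gs m /(xmon_supp gs)[k [e h]]; apply/orP; right.
apply: (@leq_ltn_trans (n + 3 * k)%N); last by apply: ltn_barS; rewrite e inE.
by rewrite -belowE; apply/belowP.
Qed.

Lemma ydeg_xmon s n : good s n -> ydeg 1 (xmon K s n).
Proof. by move=> gs m /(xmon_supp gs)[k [-> _]]; rewrite cardfs1. Qed.

(** Right-normed words only, since [V_xmon_bracket] controls brackets with a generator on the
    left. *)
Inductive lieword : ser K -> Prop :=
| lieword_V j : (j < 3)%N -> lieword (V j)
| lieword_br j w : (j < 3)%N -> lieword w -> lieword (brS (V j) w).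

Lemma brS_V_scale c p j k w : xbound c w -> homog p w ->
  brS (V j) (scaleS k w) = scaleS k (brS (V j) w).
Proof.
move=> hw pw; have hV := @xbound_V K c j; have pV := @homog_V K j.
rewrite (brS_contr hV (xbound_scale (k := k) hw) pV (homog_scale (k := k) pw)) (brS_contr hV hw pV pw).
rewrite (contrZr _ _ hw) (contrZl _ _ hV).
by apply/funext => m; rewrite /addS /scaleS; ring.
Qed.

Lemma lieword_xmon w : lieword w -> exists c s n, good s n /\ w = scaleS c (xmon K s n).
Proof.
elim=> [j j3|j {}w j3 _ [c [s [n [gs ->]]]]].
  by exists 1, [::], j; rewrite scaleS1.
rewrite (brS_V_scale _ _ (xbound_xmon 0 gs) (@homog_xmon K s n)).
have [c' [_ [s' [n' [gs' -> _]]]]] := V_xmon_bracket char2 (j3 : (j <= 2)%N) gs.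
by exists (c * c'), s', n'; rewrite scaleSS.
Qed.

Lemma lieword_xbound c w : lieword w -> xbound c w.
Proof. by move=> /lieword_xmon[k [s [n [gs ->]]]]; apply: xbound_scale; apply: xbound_xmon. Qed.

Lemma ydeg_scale d k f : ydeg d f -> ydeg d (scaleS k f).
Proof. by move=> h m; rewrite mulf_eq0 negb_or => /andP[_ /h]. Qed.

Lemma lieword_ydeg w : lieword w -> ydeg 1 w.
Proof. by move=> /lieword_xmon[k [s [n [gs ->]]]]; apply: ydeg_scale; apply: ydeg_xmon. Qed.

Lemma lieword_homog w : lieword w -> exists p, homog p w.
Proof.
by move=> /lieword_xmon[k [s [n [gs ->]]]]; exists (odd (size s).+1); apply: homog_scale;
   apply: homog_xmon.
Qed.

Lemma lieword_Vder w j : lieword w -> (j < 3)%N -> exists c, contr (V j) w = scaleS c (brS (V j) w).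
Proof.
move=> /lieword_xmon[k [s [n [gs ->]]]] j3; have h := xbound_xmon 0 gs.
have [_ [c' [_ [_ [_ _ e]]]]] := V_xmon_bracket char2 (j3 : (j <= 2)%N) gs.
exists c'; rewrite (contrZr _ _ h) -/(Vder j _) e (brS_V_scale _ _ h (@homog_xmon K s n)) !scaleSS.
by rewrite mulrC.
Qed.

Inductive lieword_span : ser K -> Prop :=
| lieword_span_0 : lieword_span (zeroS K)
| lieword_span_W w : lieword w -> lieword_span w
| lieword_span_add f g : lieword_span f -> lieword_span g -> lieword_span (addS f g)
| lieword_span_scale k f : lieword_span f -> lieword_span (scaleS k f).

Lemma lieword_span_xbound c f : lieword_span f -> xbound c f.
Proof.
by elim=> *; [exact: xbound0|exact: lieword_xbound|exact: xbound_add|exact: xbound_scale].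
Qed.

Lemma lieword_span_linear a : (forall w, lieword w -> lieword_span (contr a w)) -> forall f, lieword_span f -> lieword_span (contr a f).
Proof.
move=> h f; elim=> [|w /h //|{}f g sf IHf sg IHg|k {}f sf IH].
- by rewrite contr0r; exact: lieword_span_0.
- by rewrite (contrDr _ (lieword_span_xbound 0 sf) (lieword_span_xbound 0 sg)); exact: lieword_span_add.
- by rewrite (contrZr _ _ (lieword_span_xbound 0 sf)); exact: lieword_span_scale.
Qed.

(** The second-order terms of [contr_comp] for (a, b) and (b, a) agree up to the supercommutation
    sign and cancel. *)
Lemma contr_brS c p q a b g : xbound c a -> xbound c b -> xbound c g -> ydeg 1 a -> ydeg 1 b ->
  homog p a -> homog q b -> contr (brS a b) g
  = addS (contr a (contr b g)) (scaleS (- (-1) ^+ (p && q)) (contr b (contr a g))).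
Proof.
move=> Ha Hb Hg ya yb ha hb; rewrite (brS_contr Ha Hb ha hb) (contrDl _ _ Hg) (contrZl _ _ Hg).
rewrite (contr_comp Ha Hb Hg ya yb) (contr_comp Hb Ha Hg yb ya) (mulS_supercomm ha hb) starcZl.
by apply/funext => m; rewrite /addS /scaleS; ring.
Qed.

(** Induction on the left word, for all [f] of the span at once: the inner contraction produced by
    [contr_brS] is only known to lie in the span. *)
Lemma lieword_span_contr a f : lieword a -> lieword_span f -> lieword_span (contr a f).
Proof.
move=> wa; elim: wa f => [j j3|j w j3 ww IH] f.
  apply: lieword_span_linear => w ww; have [c ->] := lieword_Vder ww j3.
  by apply: lieword_span_scale; apply: lieword_span_W; apply: lieword_br.
move=> sf; have [q hq] := lieword_homog ww; have wV := lieword_V j3.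
rewrite (contr_brS (lieword_xbound 0 wV) (lieword_xbound 0 ww) (lieword_span_xbound 0 sf) (lieword_ydeg wV)
   (lieword_ydeg ww) (@homog_V K j) hq).
have SV g : lieword_span g -> lieword_span (contr (V j) g).
  move=> sg; apply: lieword_span_linear sg => w' ww'; have [c ->] := lieword_Vder ww' j3.
  by apply: lieword_span_scale; apply: lieword_span_W; apply: lieword_br.
by apply: lieword_span_add; [apply: SV; apply: IH|apply: lieword_span_scale; apply: IH; apply: SV].
Qed.

(** The index bounds the number of Lie words in a product. It is the measure for [prodspan_star] and
    also bounds the degree in y. *)
Inductive prodspan : nat -> ser K -> Prop :=
| prodspan_one k : prodspan k (oneS K)
| prodspan_add k f g : prodspan k f -> prodspan k g -> prodspan k (addS f g)
| prodspan_scale k c f : prodspan k f -> prodspan k (scaleS c f)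
| prodspan_mul k a f : lieword a -> prodspan k f -> prodspan k.+1 (mulS a f).

Lemma prodspan_xbound c k f : prodspan k f -> xbound c f.
Proof.
elim=> *; [exact: xbound_one|exact: xbound_add|exact: xbound_scale|].
by apply: xbound_mul => //; exact: lieword_xbound.
Qed.

Lemma prodspan_zero k : prodspan k (zeroS K).
Proof. by rewrite -(scaleS0 (oneS K)); apply: prodspan_scale; apply: prodspan_one. Qed.

Lemma prodspan_le k k' f : (k <= k')%N -> prodspan k f -> prodspan k' f.
Proof.
move=> + p; elim: p k' => {k f} [k|k f g _ IHf _ IHg|k c f _ IH|k a f wa _ IH] k' le.
- exact: prodspan_one.
- by apply: prodspan_add; [apply: IHf|apply: IHg].
- by apply: prodspan_scale; apply: IH.
- by case: k' le => // k' le; apply: prodspan_mul => //; apply: IH.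
Qed.

Lemma ydeg_mul d d' f g : ydeg d f -> ydeg d' g -> ydeg (d + d') (mulS f g).
Proof.
move=> hf hg m /mulS_neq0[A [B [_ sB /hf h1 /hg h2]]].
by move: h2; rewrite /= cardfsDS // leq_subLR => /leq_trans; apply; rewrite leq_add2r.
Qed.

Lemma ydeg_one k : ydeg k (oneS K).
Proof. by move=> m; rewrite /oneS; case: (m =P _) => [->|_]; rewrite ?eqxx // cardfs0. Qed.

Lemma prodspan_ydeg k f : prodspan k f -> ydeg k f.
Proof.
elim=> {k f} [k|k f g _ hf _ hg|k c f _ h|k a f wa _ h].
- exact: ydeg_one.
- move=> m; rewrite /addS; have [->|/hf //] := eqVneq (f m) 0.
  by rewrite add0r => /hg.
- exact: ydeg_scale.
- by rewrite -add1n; apply: ydeg_mul => //; exact: lieword_ydeg.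
Qed.

Lemma prodspan_mul_lieword_span k a f : lieword_span a -> prodspan k f -> prodspan k.+1 (mulS a f).
Proof.
move=> sa pf; elim: sa => [|w ww|a1 a2 _ h1 _ h2|c a' _ h].
- by rewrite mulS0l; exact: prodspan_zero.
- exact: prodspan_mul.
- by rewrite mulSDl; exact: prodspan_add.
- by rewrite mulSZl; exact: prodspan_scale.
Qed.

(** A derivation replaces one factor at a time by an element of [lieword_span], so the number of
    factors does not grow. *)
Lemma prodspan_contr k a f : lieword a -> prodspan k f -> prodspan k (contr a f).
Proof.
move=> wa; elim=> {k f} [k|k f g pf hf pg hg|k c f pf h|k b f wb pf h].
- by rewrite contr_oner; exact: prodspan_zero.
- by rewrite (contrDr _ (prodspan_xbound 0 pf) (prodspan_xbound 0 pg)); exact: prodspan_add.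
- by rewrite (contrZr _ _ (prodspan_xbound 0 pf)); exact: prodspan_scale.
have [p ha] := lieword_homog wa; have [q hb] := lieword_homog wb.
rewrite (contr_deriv (lieword_xbound 0 wb) (prodspan_xbound 0 pf) ha hb).
apply: prodspan_add; first by apply: prodspan_mul_lieword_span => //; apply: lieword_span_contr => //; exact: lieword_span_W.
by apply: prodspan_scale; apply: prodspan_mul.
Qed.

(** The unital associative algebra generated by the Lie words; [inP_hull] and [hull_inP] identify it
    with P. *)
Definition hull f := exists k, prodspan k f.

Lemma hull_zero : hull (zeroS K). Proof. by exists 0%N; exact: prodspan_zero. Qed.
Lemma hull_add f g : hull f -> hull g -> hull (addS f g).
Proof.
move=> [k pf] [l pg]; exists (maxn k l).
by apply: prodspan_add; [apply: prodspan_le pf|apply: prodspan_le pg]; rewrite ?leq_maxl ?leq_maxr.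
Qed.
Lemma hull_scale c f : hull f -> hull (scaleS c f).
Proof. by move=> [k pf]; exists k; exact: prodspan_scale. Qed.
Lemma hull_mul_lieword a f : lieword a -> hull f -> hull (mulS a f).
Proof. by move=> wa [k pf]; exists k.+1; exact: prodspan_mul. Qed.
Lemma hull_contr a f : lieword a -> hull f -> hull (contr a f).
Proof. by move=> wa [k pf]; exists k; exact: prodspan_contr. Qed.
Lemma hull_xbound c f : hull f -> xbound c f.
Proof. by case=> k; exact: prodspan_xbound. Qed.

(* a f = a * f - t (a |> f) reduces the star product by a product to that by its factors. *)
Lemma starc_mulS c r a f g : xbound c a -> xbound c f -> xbound c g -> ydeg 1 a ->
  starc c r.+1 (mulS a f) g = addS (addS (mulS a (starc c r.+1 f g)) (contr a (starc c r f g)))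
    (scaleS (-1) (starc c r (contr a f) g)).
Proof.
move=> Ha Hf Hg ya; apply/funext => m; have := starc_assoc r.+1 m Ha Hf Hg.
rewrite big_ord_recl big_ord_recl /= big1; last first.
  by move=> i _; rewrite (starc_big c f ya) // starc_zerol.
rewrite big_ord_recr big_ord_recr /= big1; last first.
  move=> i _; rewrite (starc_big c _ ya) //; by have := ltn_ord i; lia.
rewrite subnn subSnn subn0 !starc0 (starc1 _ Hf) (starc1 _ (starc_xbound (r := r) Hf Hg)).
rewrite /bump /= addn0 subSS subn0 addr0 add0r => /(canRL (addrK _)) ->.
by rewrite /addS /scaleS mulN1r [X in X - _]addrC.
Qed.

Lemma starc_onel c r g : starc c r.+1 (oneS K) g = zeroS K.
Proof. by apply: (starc_big _ _ (@ydeg_one 0)). Qed.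

(** Strong induction on the number of factors on the left. After [starc_mulS] the left arguments are
    [f] and [contr a f], both with one factor fewer than the product, which is why the induction is
    not over the shape of [f] alone. *)
Lemma prodspan_star k f g r : prodspan k f -> hull g -> hull (starc 0 r f g).
Proof.
move=> pf pg; have [n le] := ubnP k; elim: n k le f pf r => // n IH k le f pf.
elim: pf IH le => {k f} [k|k f f' _ hf _ hf'|k c f _ h|k a f wa pf h] IH le r.
- case: r => [|r]; first by rewrite starc0 mul1S.
  by rewrite starc_onel; exact: hull_zero.
- by rewrite starcDl; apply: hull_add; [apply: hf|apply: hf'].
- by rewrite starcZl; apply: hull_scale; apply: h.
have kn : (k < n)%N by [].
have {}IH f' : prodspan k f' -> forall r, hull (starc 0 r f' g) by move=> pf'; apply: (IH _ kn).
case: r => [|r].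
  by rewrite starc0 mulSA -(starc0 0 f); apply: hull_mul_lieword => //; apply: IH.
rewrite (starc_mulS r (lieword_xbound 0 wa) (prodspan_xbound 0 pf) (hull_xbound 0 pg) (lieword_ydeg wa)).
apply: hull_add; first apply: hull_add.
- by apply: hull_mul_lieword => //; exact: IH.
- by apply: hull_contr => //; exact: IH.
- by apply: hull_scale; apply: IH; exact: prodspan_contr.
Qed.

Lemma hull_star f g r : hull f -> hull g -> hull (starc 0 r f g).
Proof. by case=> k pf; exact: prodspan_star pf. Qed.

Lemma homog_part p f : homog p f -> part p f = f.
Proof.
move=> h; apply/funext => m; rewrite /part; case: eqP => // ne.
by apply/esym/eqP/negPn/negP => /h.
Qed.
Lemma homog_part0 p f : homog p f -> part (~~ p) f = zeroS K.
Proof.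
move=> h; apply/funext => m; rewrite /part; case: (parity m =P _) => // ne.
by apply/eqP/negPn/negP => /h e; move: ne; rewrite e; case: (p).
Qed.
Lemma partD p f g : part p (addS f g) = addS (part p f) (part p g).
Proof. by apply/funext => m; rewrite /part /addS; case: ifP => // _; rewrite addr0. Qed.
Lemma partZ p k f : part p (scaleS k f) = scaleS k (part p f).
Proof. by apply/funext => m; rewrite /part /scaleS; case: ifP => // _; rewrite mulr0. Qed.

Lemma part_mul p q a f : homog q a -> part p (mulS a f) = mulS a (part (p (+) q) f).
Proof.
move=> ha; rewrite {1}[f]part_split mulSDr partD.
have h r : homog (q (+) r) (mulS a (part r f)) := mulS_homog ha (@part_homog K r f).
have E r : part p (mulS a (part r f)) = if r == p (+) q then mulS a (part r f) else zeroS K.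
  case: eqP => [e|ne].
    by rewrite homog_part //; have := h r; rewrite {1}e addbCA addbb addbF.
  rewrite (_ : p = ~~ (q (+) r)) ?(homog_part0 (h r)) //.
  by move: ne; case: p q r {ha h} => [] [] [] // [].
by rewrite !E; case: (p (+) q) => /=; rewrite ?add0S ?addS0.
Qed.

(** P is graded because the Lie words are homogeneous; this is needed since the bracket formula
    [brS_contr] holds for homogeneous arguments. *)
Lemma prodspan_part k p f : prodspan k f -> prodspan k (part p f).
Proof.
move=> pf; elim: pf p => {k f} [k|k f g _ hf _ hg|k c f _ h|k a f wa _ h] p.
- case: p; last by rewrite (homog_part (@homog_one K)); exact: prodspan_one.
  by rewrite (homog_part0 (@homog_one K)); exact: prodspan_zero.
- by rewrite partD; apply: prodspan_add.
- by rewrite partZ; apply: prodspan_scale.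
- by have [q ha] := lieword_homog wa; rewrite (part_mul _ _ ha); apply: prodspan_mul.
Qed.

Lemma mulS_rdx_big c N f g m i : xbound c f -> (c <= N)%N -> belowm N m -> (N <= i)%N ->
  mulS (rdx i f) g m = 0.
Proof.
move=> hf cN b Ni; apply/eqP/negPn/negP => /mulS_neq0[A [B [sA sB + _]]].
rewrite /rdx; case: ifP => [_|_]; first by rewrite eqxx.
rewrite mulf_eq0 negb_or => /andP[_ /hf] /=.
have /andP[/andP[_ +] _] := belowm_split sA sB b; rewrite belowE /= => bB.
have ib : (i < barS (i |` A)%fset)%N by apply: ltn_barS; rewrite !inE eqxx.
move: ib bB cN Ni; set u := barS _; set v := barS _; lia.
Qed.

(** Additivity of a finitely supported sum requires finite supports; the bound replaces it by one
    finite range common to all arguments. *)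
Lemma brS_sum c N f g m : xbound c f -> xbound c g -> (c <= N)%N -> belowm N m ->
  brS f g m = \sum_(0 <= i < N) (mulS (rdy i f) (ldx i g) m + mulS (rdx i f) (ldy i g) m).
Proof.
move=> hf hg cN b; rewrite /brS (fsbigE (index_iota 0 N)) ?iota_uniq //.
- by apply: eq_bigl => i; rewrite in_setT.
- move=> i _; rewrite mem_iota subn0 add0n -leqNgt => Ni.
  by rewrite (mulS_ldx_big _ hg cN b Ni) (mulS_rdx_big _ hf cN b Ni) addr0.
Qed.

Lemma rdyD i f g : rdy i (addS f g) = addS (rdy i f) (rdy i g).
Proof. by apply/funext => m; rewrite /rdy /addS; case: ifP => _; rewrite ?addr0 ?mulrDr. Qed.
Lemma rdxD i f g : rdx i (addS f g) = addS (rdx i f) (rdx i g).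
Proof. by apply/funext => m; rewrite /rdx /addS; case: ifP => _; rewrite ?addr0 ?mulrDr. Qed.
Lemma ldyD i f g : ldy i (addS f g) = addS (ldy i f) (ldy i g).
Proof. by apply/funext => m; rewrite /ldy /addS; case: ifP => _; rewrite ?addr0 ?mulrDr. Qed.

Lemma brSDl c f f' g : xbound c f -> xbound c f' -> xbound c g ->
  brS (addS f f') g = addS (brS f g) (brS f' g).
Proof.
move=> hf hf' hg; apply/funext => m; rewrite /addS.
have cN := leq_maxl c (Nof m); have b : belowm (maxn c (Nof m)) m by rewrite belowmE leq_maxr.
rewrite (brS_sum hf hg cN b) (brS_sum hf' hg cN b) (brS_sum (xbound_add hf hf') hg cN b).
rewrite -big_split; apply: eq_bigr => i _ /=.
by rewrite rdyD rdxD !mulSDl /addS addrACA.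
Qed.

Lemma brSDr c f g g' : xbound c f -> xbound c g -> xbound c g' ->
  brS f (addS g g') = addS (brS f g) (brS f g').
Proof.
move=> hf hg hg'; apply/funext => m; rewrite /addS.
have cN := leq_maxl c (Nof m); have b : belowm (maxn c (Nof m)) m by rewrite belowmE leq_maxr.
rewrite (brS_sum hf hg cN b) (brS_sum hf hg' cN b) (brS_sum hf (xbound_add hg hg') cN b).
rewrite -big_split; apply: eq_bigr => i _ /=.
by rewrite ldyD ldxD !mulSDr /addS addrACA.
Qed.

Lemma hull_part p f : hull f -> hull (part p f).
Proof. by case=> k pf; exists k; exact: prodspan_part. Qed.

(** On homogeneous parts the bracket is a combination of first-order terms of the star product, so
    closure under the bracket follows from [hull_star]. *)
Lemma hull_brS f g : hull f -> hull g -> hull (brS f g).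
Proof.
have H p q f' g' : hull f' -> hull g' -> hull (brS (part p f') (part q g')).
  move=> /(hull_part p) pf /(hull_part q) pg.
  have Hf := hull_xbound 0 pf; have Hg := hull_xbound 0 pg.
  rewrite (brS_contr Hf Hg (@part_homog _ _ _) (@part_homog _ _ _)) -!(starc1 _ Hf) -!(starc1 _ Hg).
  by apply: hull_add; [|apply: hull_scale]; exact: hull_star.
move=> pf pg; rewrite [f]part_split [g]part_split.
have P p u : hull u -> xbound 0 (part p u) by move=> /(hull_part p) /hull_xbound; apply.
rewrite (brSDl (P _ _ pf) (P _ _ pf) (xbound_add (P _ _ pg) (P _ _ pg))).
rewrite !(brSDr (P _ _ pf) (P _ _ pg) (P _ _ pg)).
by apply: hull_add; apply: hull_add; exact: H.
Qed.

Lemma inP_hull f : inP f -> hull f.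
Proof.
elim=> {f} [j j3||f g _ pf _ pg|c f _ pf|f g _ pf _ pg|f g _ pf _ pg].
- by exists 1%N; rewrite -(mulS1 (V j)); apply: prodspan_mul; [exact: lieword_V|exact: prodspan_one].
- by exists 0%N; exact: prodspan_one.
- exact: hull_add.
- exact: hull_scale.
- by rewrite -(starc0 0); exact: hull_star.
- exact: hull_brS.
Qed.

Lemma lieword_inP w : lieword w -> inP w.
Proof. by elim=> *; [exact: inP_V|apply: inP_br => //; exact: inP_V]. Qed.

Lemma hull_inP f : hull f -> inP f.
Proof.
case=> k; elim=> *; [exact: inP_one|exact: inP_add|exact: inP_scale|].
by apply: inP_mul => //; exact: lieword_inP.
Qed.

End PoissonHull.

(** * The star product on P[t] and the quantization theorem *)

Section StarProperties.
Variable K : fieldType.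
Implicit Types (f g : ser K) (C D : tser K).

Lemma locp_one N m1 m : (locp K N m1 (fset0, fset0) m) = (locp0 K N m1 (fset0, fset0) m)%:P.
Proof.
rewrite /locp /locp0 (big_morph polyC (@polyCM K) (polyC1 K)); apply: eq_bigr => i _.
by rewrite /loc /loc1 /bit /= andbF mul0r addr0.
Qed.

Lemma starc_oner c r f : starc c r.+1 f (oneS K) = zeroS K.
Proof.
apply/funext => m; rewrite /starc coef_cliff_mul big1 // => m1 _; rewrite big1 // => m2 _.
rewrite /oneS; case: eqP => [->|_]; last by rewrite !mulr0.
by rewrite locp_one coefC mulr0 mul0r.
Qed.

Lemma starDl c C C' D : star c (addT C C') D = addT (star c C D) (star c C' D).
Proof.
apply/funext => n; apply/funext => m; rewrite /addT [RHS]/addS !starE -big_split.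
by apply: eq_bigr => k _; rewrite -big_split; apply: eq_bigr => l _; rewrite starcDl.
Qed.
Lemma starDr c C D D' : star c C (addT D D') = addT (star c C D) (star c C D').
Proof.
apply/funext => n; apply/funext => m; rewrite /addT [RHS]/addS !starE -big_split.
by apply: eq_bigr => k _; rewrite -big_split; apply: eq_bigr => l _; rewrite starcDr.
Qed.
Lemma starZl c k C D : star c (scaleT k C) D = scaleT k (star c C D).
Proof.
apply/funext => n; apply/funext => m; rewrite /scaleT [RHS]/scaleS !starE mulr_sumr.
by apply: eq_bigr => i _; rewrite mulr_sumr; apply: eq_bigr => l _; rewrite starcZl.
Qed.
Lemma starZr c k C D : star c C (scaleT k D) = scaleT k (star c C D).
Proof.
apply/funext => n; apply/funext => m; rewrite /scaleT [RHS]/scaleS !starE mulr_sumr.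
by apply: eq_bigr => i _; rewrite mulr_sumr; apply: eq_bigr => l _; rewrite starcZr.
Qed.

Lemma star_homog c p q C D : homogT p C -> homogT q D -> homogT (p (+) q) (star c C D).
Proof.
move=> hC hD n m; rewrite starE => /sum_neq0[k _]; rewrite -big_filter => /sum_neq0[l _].
exact: starc_homog.
Qed.

Lemma star_t c C : star c C (tT K) = shiftT C.
Proof.
apply/funext => n; apply/funext => m; rewrite starE; case: n => [|n] /=.
  by rewrite big1 // => k _; rewrite big1 // => -[[|//] ?] _; rewrite starc_zeror.
(* Only k = n and l = 1 contribute: nothing contracts with 1, so t^(n+1) arises solely from B_0(C n,
   1). *)
rewrite (bigD1 (Ordinal (leqnSn n.+1))) //= [X in _ + X]big1 ?addr0.
  rewrite (bigD1 (Ordinal (isT : 1 < n.+2)%N)) /= ?addn1 // subnn starc0 mulS1 big1 ?addr0 //.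
  move=> [l lt] /andP[_ ne]; rewrite /tT /=; case: (l =P 1%N) ne => [e|_ _]; last by rewrite starc_zeror.
  by move=> /eqP[]; apply: val_inj.
move=> [k kn] ne; rewrite big1 // => -[l ln] /= le; rewrite /tT.
case: (l =P 1%N) le => [->|_ _]; last by rewrite starc_zeror.
rewrite addn1 ltnS leq_eqVlt => /predU1P[e|lt].
  by case/eqP: ne; apply: val_inj.
by rewrite subSS -[(n - k)%N]prednK ?subn_gt0 // starc_oner.
Qed.

Lemma t_stc c C : star c (tT K) C = shiftT C.
Proof.
apply/funext => n; apply/funext => m; rewrite starE (exchange_big_dep xpredT) //=; case: n => [|n] /=.
  by rewrite big1 // => k _; rewrite big1 // => -[[|//] ?] _; rewrite starc_zerol.
rewrite (bigD1 (Ordinal (leqnSn n.+1))) //= [X in _ + X]big1 ?addr0.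
  rewrite (bigD1 (Ordinal (isT : 1 < n.+2)%N)) /= ?add1n // subnn starc0 mul1S big1 ?addr0 //.
  move=> [l lt] /andP[_ ne]; rewrite /tT /=; case: (l =P 1%N) ne => [e|_ _]; last by rewrite starc_zerol.
  by move=> /eqP[]; apply: val_inj.
move=> [k kn] ne; rewrite big1 // => -[l ln] /= le; rewrite /tT.
case: (l =P 1%N) le => [->|_ _]; last by rewrite starc_zerol.
rewrite add1n ltnS leq_eqVlt => /predU1P[e|lt].
  by case/eqP: ne; apply: val_inj.
by rewrite subSS -[(n - k)%N]prednK ?subn_gt0 // starc_onel.
Qed.

Lemma hull_sum (I : Type) (r : seq I) (P : pred I) (F : I -> ser K) :
  (forall i, hull (F i)) -> hull (fun m => \sum_(i <- r | P i) F i m).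
Proof.
move=> h; elim: r => [|i r IH].
  rewrite (_ : (fun _ => _) = zeroS K); first exact: hull_zero.
  by apply/funext => m; rewrite big_nil.
case Pi: (P i); last first.
  by rewrite (_ : (fun _ => _) = fun m => \sum_(i <- r | P i) F i m) //;
     apply/funext => m; rewrite big_cons Pi.
rewrite (_ : (fun _ => _) = addS (F i) (fun m => \sum_(i <- r | P i) F i m)); first exact: hull_add.
by apply/funext => m; rewrite big_cons Pi.
Qed.

Lemma ydeg_le d d' f : (d <= d')%N -> ydeg d f -> ydeg d' f.
Proof. by move=> le h m /h /leq_trans; apply. Qed.

Hypothesis char2 : (2%:R : K) != 0.

Lemma inP_stc C D n : (forall k, inP (C k)) -> (forall k, inP (D k)) -> inP (star 0 C D n).
Proof.
move=> hC hD; apply: hull_inP.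
rewrite (_ : star 0 C D n = fun m => \sum_(k < n.+1)
   (fun m => \sum_(l < n.+1 | (k + l <= n)%N) starc 0 (n - (k + l)) (C k) (D l) m) m).
  by apply: hull_sum => k; apply: hull_sum => l; apply: hull_star => //; exact: inP_hull.
by apply/funext => m; rewrite starE.
Qed.

Lemma inP_ydeg_bound C N : (forall k, inP (C k)) ->
  exists d, forall k, (k < N)%N -> ydeg d (C k).
Proof.
move=> hC; elim: N => [|N [d hd]]; first by exists 0%N.
have [d' /(prodspan_ydeg char2) hd'] := inP_hull char2 (hC N); exists (maxn d d') => k.
rewrite ltnS leq_eqVlt => /predU1P[->|/hd hk].
  exact: (ydeg_le (leq_maxr _ _) hd').
exact: (ydeg_le (leq_maxl _ _) hk).
Qed.

(** Finiteness in t: the finitely many nonzero coefficients of [C] have a common bound on the degree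
    in y, which bounds the number of contractions. *)
Lemma inPt_stc C D : inPt C -> inPt D -> inPt (star 0 C D).
Proof.
move=> [hC [N1 z1]] [hD [N2 z2]]; split; first by move=> n; exact: inP_stc.
have [d hd] := inP_ydeg_bound N1 hC.
(* For k < N1 and l < N2 more than d contractions would be needed to reach t^n. *)
exists (N1 + N2 + d)%N => n le; apply/funext => m; rewrite starE big1 // => k _.
rewrite big1 // => l kl; have [k1|k1] := leqP N1 k; first by rewrite z1 // starc_zerol.
have [l1|l1] := leqP N2 l; first by rewrite z2 // starc_zeror.
by rewrite (starc_big _ _ (hd _ k1)) //; lia.
Qed.

Lemma inP_xbound c f : inP f -> xbound c f.
Proof. by move=> /(inP_hull char2)/hull_xbound; apply. Qed.

End StarProperties.

Theorem theorem10p7 (K : fieldType) (char2 : (2%:R : K) != 0) :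
  exists star : tser K -> tser K -> tser K,
    (* a product on P[t] *)
    (forall f g, inPt f -> inPt g -> inPt (star f g)) /\
    (* K-bilinear *)
    (forall f1 f2 g, inPt f1 -> inPt f2 -> inPt g ->
       star (addT f1 f2) g = addT (star f1 g) (star f2 g) /\
       star g (addT f1 f2) = addT (star g f1) (star g f2)) /\
    (forall (c : K) f g, inPt f -> inPt g ->
       star (scaleT c f) g = scaleT c (star f g) /\
       star f (scaleT c g) = scaleT c (star f g)) /\
    (* associative *)
    (forall f g h, inPt f -> inPt g -> inPt h ->
       star (star f g) h = star f (star g h)) /\
    (* compatible with the Z/2-grading P[t] = P_0[t] (+) P_1[t] *)
    (forall (p q : bool) f g, inPt f -> inPt g -> homogT p f -> homogT q g ->
       homogT (p (+) q) (star f g)) /\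
    (* a * b = a . b  (mod t) *)
    (forall a b, inP a -> inP b -> star (constT a) (constT b) 0%N = mulS a b) /\
    (* a * b - (-1)^{|a||b|} b * a = t {a, b}  (mod t^2) *)
    (forall (p q : bool) a b, inP a -> inP b -> homog p a -> homog q b ->
       addS (star (constT a) (constT b) 0%N)
            (scaleS (- (-1) ^+ (p && q)) (star (constT b) (constT a) 0%N)) = zeroS K /\
       addS (star (constT a) (constT b) 1%N)
            (scaleS (- (-1) ^+ (p && q)) (star (constT b) (constT a) 1%N)) = brS a b) /\
    (* f * t = t * f = f t *)
    (forall f, inPt f -> star f (tT K) = shiftT f /\ star (tT K) f = shiftT f).
Proof.
have HP (f : tser K) : inPt f -> forall k, xbound 0 (f k) by move=> [h _] k; exact: (inP_xbound char2 0 (h k)).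
(* The value c = 0 of the support bound is the condition defining H~. *)
exists (star 0); split; first by move=> f g; exact: (inPt_stc char2).
split; first by move=> f1 f2 g _ _ _; rewrite starDl starDr.
split; first by move=> c f g _ _; rewrite starZl starZr.
split; first by move=> f g h /HP hf /HP hg /HP hh; exact: star_assoc.
split; first by move=> p q f g _ _; exact: star_homog.
split; first by move=> a b _ _; rewrite star_const starc0.
split; last by move=> f _; rewrite star_t t_stc.
move=> p q a b /(inP_xbound char2 0) Ha /(inP_xbound char2 0) Hb ha hb; rewrite !star_const !starc0; split.
  rewrite (mulS_supercomm ha hb); apply/funext => m.
  by rewrite /addS /scaleS /zeroS mulNr subrr.
by rewrite (starc1 _ Ha) (starc1 _ Hb) (brS_contr Ha Hb ha hb).
Qed.
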